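(* Let $C,D_k:\Omega\times\Delta^{\mathrm{c}}[0,\infty)\to\mathbb{R}^{n\times n}$, $k=1,\dots,d$, be measurable, with $C(t,\cdot),D_k(t,\cdot)$ adapted for each $t\ge0$, and suppose there exist $K_C\in L^{1,*}(0,\infty;\mathbb{R}_+)$ and $K_D\in L^{2,*}(0,\infty;\mathbb{R}_+)$ such that $|C(t,s)|\le K_C(t-s)$ and $\bigl(\sum_{k=1}^d|D_k(t,s)|^2\bigr)^{1/2}\le K_D(t-s)$ for a.e. $(t,s)\in\Delta^{\mathrm{c}}[0,\infty)$, a.s. Put $\rho_{C,D}:=\inf\{\rho\in\mathbb{R}:[K_C]_1(\rho)+[K_D]_2(\rho)\le1\}$, and let $\mu,\eta,\lambda\in\mathbb{R}$ satisfy $\eta+\lambda\ge\mu>\rho_{C,D}$. For given $\varphi(\cdot)\in L^{2,-\mu}_{\mathbb{F}}(0,\infty;\mathbb{R}^n)$ and $\psi(\cdot)\in L^{2,\eta}_{\mathcal{F}_\infty}(0,\infty;\mathbb{R}^n)$, let $X(\cdot)\in L^{2,-\mu}_{\mathbb{F}}(0,\infty;\mathbb{R}^n)$ be the solution of $$X(t)=\varphi(t)+\int_0^tC(t,s)X(s)\,ds+\sum_{k=1}^d\int_0^tD_k(t,s)X(s)\,dW_k(s),\quad t\ge0,$$ and let $(Y(\cdot),Z(\cdot,\cdot))\in\mathcal{M}^{2,\eta}_{\mathbb{F}}(0,\infty;\mathbb{R}^n\times\mathbb{R}^{n\times d})$ be the adapted M-solution of $$Y(t)=\psi(t)+\int_t^\infty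 e^{-\lambda(s-t)}\Bigl\{C(s,t)^\top Y(s)+\sum_{k=1}^dD_k(s,t)^\top Z^k(s,t)\Bigr\}ds-\int_t^\infty Z(t,s)\,dW(s),\quad t\ge0.$$ Then $$\mathbb{E}\Bigl[\int_0^\infty e^{-\lambda t}\langle\psi(t),X(t)\rangle\,dt\Bigr]=\mathbb{E}\Bigl[\int_0^\infty e^{-\lambda t}\langle Y(t),\varphi(t)\rangle\,dt\Bigr].$$
   Context: $(\Omega,\mathcal{F},\mathbb{P})$ is a complete probability space with a $d$-dimensional Brownian motion $W=(W_1,\dots,W_d)^\top$; $\mathbb{F}=(\mathcal{F}_t)_{t\ge0}$ is the $\mathbb{P}$-augmented filtration generated by $W$; $\mathcal{F}_\infty=\bigvee_{t\ge0}\mathcal{F}_t$. Matrices carry the Frobenius norm $|\cdot|$. For $z\in\mathbb{R}^{n\times d}$, $z^k$ is the $k$-th column, and $\int z\,dW=\sum_{k=1}^d\int z^k\,dW_k$. $\Delta^{\mathrm{c}}[0,\infty)=\{(t,s):0\le s\le t<\infty\}$. For $p\in\{1,2\}$, $L^{p,*}(0,\infty;\mathbb{R}_+)$ is the set of measurable $f:[0,\infty)\to\mathbb{R}_+$ such that $\int_0^\infty e^{p\beta t}f(t)^p\,dt<\infty$ for some $\beta\in\mathbb{R}$; for such $f$ and $\rho\in\mathbb{R}$, $[f]_p(\rho):=\bigl(\int_0^\infty e^{-p\rho t}f(t)^p\,dt\bigr)^{1/p}\in[0,\infty]$. For $\beta\in\mathbb{R}$: $L^{2,\beta}_{\mathcal{F}_\infty}(0,\infty;\mathbb{R}^n)$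 is the set of $\mathcal{F}_\infty\otimes\mathcal{B}([0,\infty))$-measurable $f:\Omega\times[0,\infty)\to\mathbb{R}^n$ (not necessarily adapted) with $\mathbb{E}\int_0^\infty e^{2\beta t}|f(t)|^2dt<\infty$; $L^{2,\beta}_{\mathbb{F}}(0,\infty;\mathbb{R}^n)$ is its subset of adapted processes; $\mathscr{L}^{2,\beta}_{\mathbb{F}}(0,\infty;\mathbb{R}^{n\times d})$ is the set of $\mathcal{F}\otimes\mathcal{B}([0,\infty)^2)$-measurable $f:\Omega\times[0,\infty)^2\to\mathbb{R}^{n\times d}$ such that $f(t,\cdot)$ is adapted for a.e. $t\ge0$ and $\mathbb{E}\int_0^\infty e^{2\beta t}\int_0^\infty|f(t,s)|^2\,ds\,dt<\infty$. $\mathcal{M}^{2,\beta}_{\mathbb{F}}(0,\infty;\mathbb{R}^n\times\mathbb{R}^{n\times d})$ is the set of $(y,z)\in L^{2,\beta}_{\mathbb{F}}(0,\infty;\mathbb{R}^n)\times\mathscr{L}^{2,\beta}_{\mathbb{F}}(0,\infty;\mathbb{R}^{n\times d})$ with $y(t)=\mathbb{E}[y(t)]+\int_0^tz(t,s)\,dW(s)$ for a.e. $t\ge0$, a.s. A solution of the forward equation is a process in $\bigcup_\beta L^{2,\beta}_{\mathbb{F}}$ satisfying it for a.e. $t\ge0$, a.s.; an adapted M-solution of the backward equation is a pair in $\bigcup_\beta\mathcal{M}^{2,\beta}_{\mathbb{F}}$ satisfying it for a.e. $t\ge0$, a.s. Under the hypotheses of the claim, $X$ exists and is unique in $L^{2,-\mu}_{\mathbb{F}}$,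 and $(Y,Z)$ exists and is unique in $\mathcal{M}^{2,\eta}_{\mathbb{F}}$. *)

(* Defs.v *)
From mathcomp Require Import all_boot all_order all_algebra.
From mathcomp Require Import all_classical all_reals all_analysis.

Set Implicit Arguments.
Unset Strict Implicit.
Unset Printing Implicit Defensive.

Import Order.TTheory GRing.Theory Num.Theory.
Import numFieldNormedType.Exports.

Local Open Scope classical_set_scope.
Local Open Scope ring_scope.

(* Time [0, oo) is the subset `[0, +oo[ of R. A process f : R -> Om -> V is
   written time first; all conditions on f concern nonnegative times only. *)

Section Volterra.
Context (disp : measure_display) (Om : measurableType disp) (R : realType).
Variable P : probability Om R.
Local Notation mu := (@lebesgue_measure R).
Local Notation halfline := (`[0, +oo[%classic : set R).

(* The norm of the library on matrices is the maximum norm. *)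
Definition frob (m n : nat) (A : 'M[R]_(m, n)) : R :=
  Num.sqrt (\sum_i \sum_j A i j ^+ 2).

Definition inner (n : nat) (x y : 'cV[R]_n) : R := \sum_i x i 0 * y i 0.

Definition vint (n : nat) (A : set R) (f : R -> 'cV[R]_n) : 'cV[R]_n :=
  \col_i (\int[mu]_(s in A) f s i 0)%R.

Definition vexpect (n : nat) (X : Om -> 'cV[R]_n) : 'cV[R]_n :=
  \col_i fine 'E_P[fun w => X w i 0].

Definition triangle : set (R * R) := [set u | 0 <= u.2 <= u.1].

Section Brownian.
Variables (d : nat) (W : 'I_d -> R -> Om -> R).

Definition past_events (t : R) : set (set Om) :=
  [set A | exists k s B, [/\ 0 <= s <= t, measurable B & A = W k s @^-1` B]].

Definition increment_events (s t : R) : set (set Om) :=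
  [set A | exists k B, measurable B /\ A = (fun w => W k t w - W k s w) @^-1` B].

Record brownian_motion : Prop := BrownianMotion {
  bm_measurable : forall k (t : R), 0 <= t -> measurable_fun setT (W k t);
  bm_start : {ae P, forall w, forall k, W k 0 w = 0};
  bm_continuous : {ae P, forall w, forall k,
    {within halfline, continuous (fun t => W k t w)}};
  (* W t - W s follows the law N(0, (t - s) I_d); the second parameter of
     normal_prob is the standard deviation. *)
  bm_gaussian : forall s t : R, 0 <= s < t ->
    forall B : 'I_d -> set R, (forall k, measurable (B k)) ->
    P [set w | forall k, B k (W k t w - W k s w)] =
      (\prod_k normal_prob 0 (Num.sqrt (t - s)) (B k))%E;
  bm_independent : forall s t : R, 0 <= s < t ->
    forall A E, <<s past_events s >> A -> <<s increment_events s t >> E ->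
    P (A `&` E) = (P A * P E)%E }.

(* When P is complete, the negligible sets are exactly the P-null events. *)
Definition augmented_filtration (t : R) : set (set Om) :=
  <<s past_events t `|` [set N | P.-negligible N] >>.

Definition filtration_infty : set (set Om) :=
  <<s \bigcup_(t in halfline) augmented_filtration t >>.

Definition F_measurable (t : R) (f : Om -> R) : Prop :=
  measurable_fun setT (f : g_sigma_algebraType (augmented_filtration t) -> R).

Definition adapted (m n : nat) (f : R -> Om -> 'M[R]_(m, n)) : Prop :=
  forall t, 0 <= t -> forall i j, F_measurable t (fun w => f t w i j).

(* \sum_(i < N) xi_i * 1_(a_i, b_i], the intervals may overlap. *)
Record simple_process := SimpleProcess {
  sp_size : nat;
  sp_lo : 'I_sp_size -> R;
  sp_hi : 'I_sp_size -> R;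
  sp_coef : 'I_sp_size -> Om -> R;
  sp_itv : forall i, 0 <= sp_lo i <= sp_hi i;
  sp_adapted : forall i, F_measurable (sp_lo i) (sp_coef i);
  sp_bounded : forall i, exists M : R, forall w, `|sp_coef i w| <= M }.

Definition simple_value (H : simple_process) (s : R) (w : Om) : R :=
  \sum_i sp_coef (s := H) i w * \1_(`]sp_lo i, sp_hi i]%classic) s.

Definition simple_integral (k : 'I_d) (H : simple_process) (w : Om) : R :=
  \sum_i sp_coef (s := H) i w * (W k (sp_hi i) w - W k (sp_lo i) w).

(* I is (a version of) the L^2 Ito integral of f with respect to W k over the
   set A of times: simple processes converge to 1_A f in L^2(P x dt) and their
   integrals converge to I in L^2(P). *)
Definition is_ito1 (k : 'I_d) (A : set R) (f : R -> Om -> R) (I : Om -> R) :=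
  [/\ measurable_fun (setT `*` A) (fun x : Om * R => f x.2 x.1),
      measurable_fun setT I &
      exists H : nat -> simple_process,
          (\int[P]_w \int[mu]_(s in halfline)
             ((simple_value (H m) s w - \1_A s * f s w) ^+ 2)%:E)%E
            @[m --> \oo] --> 0%E /\
          (\int[P]_w ((simple_integral k (H m) w - I w) ^+ 2)%:E)%E
            @[m --> \oo] --> 0%E].

(* int_A z dW = \sum_k int_A z^k dW_k, with z^k the k-th column of z. *)
Definition is_ito (n : nat) (A : set R) (z : R -> Om -> 'M[R]_(n, d))
    (I : Om -> 'cV[R]_n) : Prop :=
  exists J : 'I_n -> 'I_d -> Om -> R,
    (forall i k, is_ito1 k A (fun s w => z s w i k) (J i k)) /\
    (forall w, I w = \col_i \sum_k J i k w).

(* L^{p,*}(0, oo; R_+); only p = 1, 2 are used. *)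
Definition Lstar (p : nat) (f : R -> R) : Prop :=
  [/\ measurable_fun halfline f, forall t, 0 <= t -> 0 <= f t &
      exists beta : R,
      (\int[mu]_(t in halfline) (expR (p%:R * beta * t) * f t ^+ p)%:E
         < +oo)%E].

(* [f]_p(rho), with values in [0, +oo]. *)
Definition bracket (p : nat) (f : R -> R) (rho : R) : \bar R :=
  poweR (\int[mu]_(t in halfline) (expR (- (p%:R * rho * t)) * f t ^+ p)%:E)%E
    p%:R^-1.

(* The infimum is taken in \bar R: it is -oo e.g. for KC = KD = 0. *)
Definition rho_CD (KC KD : R -> R) : \bar R :=
  ereal_inf [set rho%:E | rho in
    [set rho : R | (bracket 1 KC rho + bracket 2 KD rho <= 1)%E]].

Definition L2_Finfty (n : nat) (beta : R) (f : R -> Om -> 'cV[R]_n) : Prop :=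
  (forall i, measurable_fun (setT `*` halfline)
     (fun x : g_sigma_algebraType filtration_infty * R => f x.2 x.1 i 0)) /\
  (\int[P]_w \int[mu]_(t in halfline)
     (expR (2 * beta * t) * frob (f t w) ^+ 2)%:E < +oo)%E.

Definition L2_F (n : nat) (beta : R) (f : R -> Om -> 'cV[R]_n) : Prop :=
  L2_Finfty beta f /\ adapted f.

Definition L2_F2 (n : nat) (beta : R) (f : R -> R -> Om -> 'M[R]_(n, d)) :
    Prop :=
  [/\ forall i k, measurable_fun (setT `*` (halfline `*` halfline))
        (fun x : Om * (R * R) => f x.2.1 x.2.2 x.1 i k),
      {ae mu, forall t, 0 <= t -> adapted (f t)} &
      (\int[P]_w \int[mu]_(t in halfline)
         ((expR (2 * beta * t))%:E *
          \int[mu]_(s in halfline) (frob (f t s w) ^+ 2)%:E) < +oo)%E].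

Definition M2_F (n : nat) (beta : R) (y : R -> Om -> 'cV[R]_n)
    (z : R -> R -> Om -> 'M[R]_(n, d)) : Prop :=
  [/\ L2_F beta y, L2_F2 beta z &
      {ae mu, forall t, 0 <= t ->
        exists I : Om -> 'cV[R]_n,
          is_ito `[0, t]%classic (z t) I /\
          {ae P, forall w, y t w = vexpect (y t) + I w}}].

Definition triangle_process (n : nat) (C : R -> R -> Om -> 'M[R]_n) : Prop :=
  (forall i j, measurable_fun (setT `*` triangle)
     (fun x : Om * (R * R) => C x.2.1 x.2.2 x.1 i j)) /\
  (forall t s : R, 0 <= s <= t -> forall i j,
     F_measurable s (fun w => C t s w i j)).

Definition forward_SVIE (n : nat) (C : R -> R -> Om -> 'M[R]_n)
    (D : 'I_d -> R -> R -> Om -> 'M[R]_n) (phi X : R -> Om -> 'cV[R]_n) : Prop :=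
  {ae mu, forall t, 0 <= t ->
    exists I : Om -> 'cV[R]_n,
      is_ito `[0, t]%classic
        (fun s w => \matrix_(i, k) (D k t s w *m X s w) i 0) I /\
      {ae P, forall w,
        X t w = phi t w
          + vint `[0, t]%classic (fun s => C t s w *m X s w) + I w}}.

Definition backward_SVIE (n : nat) (C : R -> R -> Om -> 'M[R]_n)
    (D : 'I_d -> R -> R -> Om -> 'M[R]_n) (lambda : R)
    (psi Y : R -> Om -> 'cV[R]_n) (Z : R -> R -> Om -> 'M[R]_(n, d)) : Prop :=
  {ae mu, forall t, 0 <= t ->
    exists I : Om -> 'cV[R]_n,
      is_ito `[t, +oo[%classic (Z t) I /\
      {ae P, forall w,
        Y t w = psi t w
          + vint `[t, +oo[%classic (fun s => expR (- lambda * (s - t)) *: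
              ((C s t w)^T *m Y s w
               + \sum_k (D k s t w)^T *m col k (Z s t w)))
          - I w}}.

End Brownian.
End Volterra.

(* Main.v *)
(* Write [e^(-lambda t) E <Y(t), X(t)>] in two ways. Substituting the forward
   equation for X(t), the drift pairs C(t,s) X(s) with Y(t), and as
   Y(t) = E Y(t) + int_0^t Z(t,s) dW(s), the Ito isometry turns the stochastic
   integral into E int_0^t sum_k <D_k(t,s) X(s), Z^k(t,s)> ds. Substituting the
   backward equation for Y(t), the stochastic integral over [t, oo) is orthogonal
   to the F_t-measurable X(t), which leaves the same pairings with the roles of s
   and t exchanged. Integrating over t, the two double integrals agree by Fubini.
   They converge absolutely: since mu <= eta + lambda,
   e^(-lambda t) |Y(t)| |X(s)| <= e^(-mu (t-s)) (e^(eta t) |Y(t)|) (e^(-mu s) |X(s)|)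
   for t >= 0, and mu > rho_CD makes e^(-mu r) K_C(r) and (e^(-mu r) K_D(r))^2
   integrable. *)
Require Import Defs.
From HB Require Import structures.
From mathcomp Require Import all_boot all_order all_algebra.
From mathcomp Require Import all_classical all_reals all_analysis.
From mathcomp Require Import measurable_realfun ring lra.
Import Order.TTheory GRing.Theory Num.Theory.
Import numFieldNormedType.Exports.
Local Open Scope classical_set_scope.
Local Open Scope ring_scope.
Set Implicit Arguments.
Unset Strict Implicit.
Unset Printing Implicit Defensive.

(** * Square-integrable functions *)

(** Ito integrals are available only as L^2 limits of integrals of simple processes, chosen
    separately for each time [t], with no joint measurability in time and sample point. Every
    identity that involves one is therefore proved at a fixed [t] as an equality of real numbers,
    after taking expectations, and only these numbers are integrated over time. The isometry and the
    orthogonality to the past both come down to covariances of Brownian increments weighted by a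
    bounded past variable, and pass to the limit by continuity of the L^2 inner product. Kernels and
    processes are extended by zero to all real times, with the triangle built into the kernels. The
    integral over s in [0, t] of the forward equation and the one over s in [t, oo) of the backward
    equation then become partial integrals of a single function on Om x R x R. The kernel classes
    match the AM-GM splittings: [Y] depends on one time and leaves two convolutions with the
    weighted [KC], while [Z] is square-integrable in both times jointly and leaves [KD] squared
    against [X] squared. *)

Section SquareIntegrable.
Context d (T : measurableType d) (R : realType).
Variable m : {measure set T -> \bar R}.
Implicit Types f g h : T -> R.

Definition summable_fun (f : T -> R) : Prop := m.-integrable setT (EFin \o f).

Definition sqint (f : T -> R) : Prop :=
  measurable_fun setT f /\ summable_fun (fun x => f x ^+ 2).

Definition ip (f g : T -> R) : R := (\int[m]_x (f x * g x))%R.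

Lemma summable_measurable f : summable_fun f -> measurable_fun setT f.
Proof. by move=> /measurable_int/measurable_EFinP. Qed.

Lemma summable_le f g : measurable_fun setT f ->
  (forall x, `|f x| <= g x) -> summable_fun g -> summable_fun f.
Proof.
move=> mf fg; apply: le_integrable => //; first exact/measurable_EFinP.
move=> x _ /=; rewrite lee_fin; apply: le_trans (fg x) _; exact: ler_norm.
Qed.

Lemma eq_summable f g : f =1 g -> summable_fun f -> summable_fun g.
Proof. by move=> /funext ->. Qed.

Lemma eq_sqint f g : f =1 g -> sqint f -> sqint g.
Proof. by move=> /funext ->. Qed.

Lemma summableD f g : summable_fun f -> summable_fun g ->
  summable_fun (fun x => f x + g x).
Proof. by move=> sf sg; exact: (integrableD measurableT sf sg). Qed.

Lemma summableZ c f : summable_fun f -> summable_fun (fun x => c * f x).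
Proof. by move=> sf; exact: (integrableZl measurableT c sf). Qed.

Lemma summableB f g : summable_fun f -> summable_fun g ->
  summable_fun (fun x => f x - g x).
Proof. by move=> sf sg; exact: (integrableB measurableT sf sg). Qed.

Lemma summable_norm f : summable_fun f -> summable_fun (fun x => `|f x|).
Proof. exact: integrable_norm. Qed.

Lemma summable0 : summable_fun (fun=> 0).
Proof. exact: integrable0. Qed.

Lemma summable_sum I (s : seq I) (P : pred I) (f : I -> T -> R) :
  (forall i, P i -> summable_fun (f i)) ->
  summable_fun (fun x => \sum_(i <- s | P i) f i x).
Proof.
move=> sf; elim: s => [|i s ih].
  by apply: eq_summable summable0 => x; rewrite big_nil.
have [Pi|nPi] := boolP (P i); last first.
  by apply: eq_summable ih => x; rewrite big_cons (negbTE nPi).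
by apply: eq_summable (summableD (sf i Pi) ih) => x; rewrite big_cons Pi.
Qed.

Lemma RintegralD_summable f g : summable_fun f -> summable_fun g ->
  (\int[m]_x (f x + g x) = \int[m]_x f x + \int[m]_x g x)%R.
Proof. exact: RintegralD. Qed.

Lemma Rintegral_sum I (s : seq I) (P : pred I) (f : I -> T -> R) :
  (forall i, P i -> summable_fun (f i)) ->
  (\int[m]_x (\sum_(i <- s | P i) f i x) =
   \sum_(i <- s | P i) \int[m]_x f i x)%R.
Proof.
move=> sf; elim: s => [|i s ih].
  under eq_Rintegral do rewrite big_nil.
  by rewrite big_nil /Rintegral integral0.
under eq_Rintegral do rewrite big_cons.
rewrite big_cons; case: ifPn => // Pi.
by rewrite RintegralD_summable ?ih//; [exact: sf|exact: summable_sum].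
Qed.

Lemma sqint_mul f g : sqint f -> sqint g -> summable_fun (fun x => f x * g x).
Proof.
move=> [mf sf] [mg sg]; apply: (@summable_le _ (fun x => f x ^+ 2 + g x ^+ 2)).
- exact: measurable_funM.
- move=> x; rewrite ler_norml; apply/andP; split; nra.
- exact: summableD.
Qed.

Lemma sqintD f g : sqint f -> sqint g -> sqint (fun x => f x + g x).
Proof.
move=> sf sg; split; first exact: measurable_funD sf.1 sg.1.
apply: eq_summable (summableD (summableD sf.2 sg.2)
  (summableZ 2 (sqint_mul sf sg))) => x.
by rewrite sqrrD mulrC mulr_natr addrAC.
Qed.

Lemma sqintZ c f : sqint f -> sqint (fun x => c * f x).
Proof.
move=> [mf sf]; split; first exact: measurable_funM.
by apply: eq_summable (summableZ (c ^+ 2) sf) => x; rewrite exprMn.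
Qed.

Lemma sqintB f g : sqint f -> sqint g -> sqint (fun x => f x - g x).
Proof.
move=> sf sg; apply: eq_sqint (sqintD sf (sqintZ (-1) sg)) => x.
by rewrite mulN1r.
Qed.

Lemma sqint_sum I (s : seq I) (P : pred I) (f : I -> T -> R) :
  (forall i, P i -> sqint (f i)) ->
  sqint (fun x => \sum_(i <- s | P i) f i x).
Proof.
move=> sf; elim: s => [|i s ih].
  apply: (@eq_sqint (fun=> 0)) => [x|]; first by rewrite big_nil.
  by split => //; apply: eq_summable summable0 => x; rewrite expr0n.
have [Pi|nPi] := boolP (P i); last first.
  by apply: eq_sqint ih => x; rewrite big_cons (negbTE nPi).
by apply: eq_sqint (sqintD (sf i Pi) ih) => x; rewrite big_cons Pi.
Qed.

Lemma sqint_lty f : measurable_fun setT f ->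
  (\int[m]_x ((f x) ^+ 2)%:E < +oo)%E -> sqint f.
Proof.
move=> mf foo; split => //; apply/integrableP; split.
  by apply/measurable_EFinP; exact: measurable_funX.
under eq_integral do rewrite gee0_abs ?lee_fin ?sqr_ge0//.
exact: foo.
Qed.

Lemma ipC f g : ip f g = ip g f.
Proof. by apply: eq_Rintegral => x _; rewrite mulrC. Qed.

Lemma ip_sqr f : sqint f -> (ip f f)%:E = (\int[m]_x ((f x) ^+ 2)%:E)%E.
Proof.
move=> [mf sf]; rewrite /ip /Rintegral.
by under eq_integral do rewrite -expr2; rewrite fineK//; exact: integrable_fin_num.
Qed.

Lemma ip_ge0 f : 0 <= ip f f.
Proof. by apply: Rintegral_ge0 => x _; rewrite -expr2 sqr_ge0. Qed.

Lemma ipDl f g h : sqint f -> sqint g -> sqint h ->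
  ip (fun x => f x + g x) h = ip f h + ip g h.
Proof.
move=> sf sg sh; rewrite /ip -RintegralD//; last 2 first.
- exact: sqint_mul.
- exact: sqint_mul.
by apply: eq_Rintegral => x _; rewrite mulrDl.
Qed.

Lemma ipZl c f h : sqint f -> sqint h -> ip (fun x => c * f x) h = c * ip f h.
Proof.
move=> sf sh; rewrite /ip -RintegralZl//; last exact: sqint_mul.
by apply: eq_Rintegral => x _; rewrite mulrA.
Qed.

Lemma ipDr f g h : sqint f -> sqint g -> sqint h ->
  ip h (fun x => f x + g x) = ip h f + ip h g.
Proof. by move=> sf sg sh; rewrite ipC ipDl// !(ipC _ h). Qed.

Lemma ipZr c f h : sqint f -> sqint h -> ip h (fun x => c * f x) = c * ip h f.
Proof. by move=> sf sh; rewrite ipC ipZl// (ipC _ h). Qed.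

Lemma ip_suml I (s : seq I) (P : pred I) (f : I -> T -> R) h :
  (forall i, P i -> sqint (f i)) -> sqint h ->
  ip (fun x => \sum_(i <- s | P i) f i x) h = \sum_(i <- s | P i) ip (f i) h.
Proof.
move=> sf sh; rewrite /ip -Rintegral_sum.
  by apply: eq_Rintegral => x _; rewrite mulr_suml.
by move=> i Pi; apply: sqint_mul => //; exact: sf.
Qed.

Lemma ip_sumr I (s : seq I) (P : pred I) (f : I -> T -> R) h :
  (forall i, P i -> sqint (f i)) -> sqint h ->
  ip h (fun x => \sum_(i <- s | P i) f i x) = \sum_(i <- s | P i) ip h (f i).
Proof.
move=> sf sh; rewrite ipC ip_suml//.
by apply: eq_bigr => i _; rewrite ipC.
Qed.

(** The quadratic polynomial r |-> ip (f + r g) (f + r g) is nonnegative, so its discriminant is at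
    most 0. *)
Lemma cauchy_schwarz f g : sqint f -> sqint g ->
  `|ip f g| <= Num.sqrt (ip f f) * Num.sqrt (ip g g).
Proof.
move=> sf sg; rewrite -sqrtrM ?ip_ge0//.
rewrite -(@ler_pXn2r _ 2) ?nnegrE ?sqrtr_ge0//.
rewrite sqr_sqrtr ?mulr_ge0 ?ip_ge0// real_normK ?num_real//.
pose p := Poly [:: ip f f; 2 * ip f g; ip g g].
have : p`_1 ^+ 2 - 4 * p`_2 * p`_0 <= 0.
  apply: deg_le2_poly_ge0; first by rewrite size_Poly.
  move=> r; rewrite horner_Poly/=.
  suff -> : ((0 * r + ip g g) * r + 2 * ip f g) * r + ip f f =
      ip (fun x => f x + r * g x) (fun x => f x + r * g x) by exact: ip_ge0.
  have srg := sqintZ r sg; have sfrg := sqintD sf srg.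
  by rewrite ipDl// ipZl// !ipDr// !ipZr// (ipC g f); ring.
rewrite !coefE/= => h; nra.
Qed.

(** Convergence to 0 in the extended reals makes the distance finite from some index [N] on, and f =
    f_N - (f_N - f) is then a difference of square-integrable functions. *)
Lemma sqint_cvg (f_ : nat -> T -> R) f :
  (forall n, sqint (f_ n)) -> measurable_fun setT f ->
  (\int[m]_x ((f_ n x - f x) ^+ 2)%:E)%E @[n --> \oo] --> 0%E ->
  sqint f /\ Num.sqrt (ip (fun x => f_ n x - f x) (fun x => f_ n x - f x))
    @[n --> \oo] --> 0.
Proof.
move=> sf mf cv.
have mB n : measurable_fun setT (fun x => f_ n x - f x).
  by apply: measurable_funB => //; exact: (sf n).1.
have [cvf cv0] : (\forall n \near \oo,
    ((\int[m]_x ((f_ n x - f x) ^+ 2)%:E)%E \is a fin_num)) /\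
    (fine (\int[m]_x ((f_ n x - f x) ^+ 2)%:E)%E) @[n --> \oo] --> (0 : R).
  by apply/fine_cvgP.
have sF : sqint f.
  have [N _ /(_ N (leqnn N)) /= fN] := cvf.
  have sN : sqint (fun x => f_ N x - f x).
    by apply: sqint_lty => //; rewrite ltey_eq fN.
  by apply: eq_sqint (sqintB (sf N) sN) => x; rewrite subKr.
split => //; have := cvg_comp _ _ cv0 (@sqrt_continuous R 0); rewrite sqrtr0.
set u := (X in X @ _ --> _); set v := (X in _ -> X @ _ --> _).
suff -> : u = v by [].
by apply/funext => n; congr Num.sqrt.
Qed.

(** Writing f_n = (f_n - f) + f, and likewise for g, and expanding leaves three error terms, each
    with a factor that tends to 0; Cauchy-Schwarz bounds them by the norms [a n] and [b n]. *)
Lemma ip_cvg (f_ g_ : nat -> T -> R) f g :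
  (forall n, sqint (f_ n)) -> (forall n, sqint (g_ n)) ->
  measurable_fun setT f -> measurable_fun setT g ->
  (\int[m]_x ((f_ n x - f x) ^+ 2)%:E)%E @[n --> \oo] --> 0%E ->
  (\int[m]_x ((g_ n x - g x) ^+ 2)%:E)%E @[n --> \oo] --> 0%E ->
  [/\ sqint f, sqint g & ip (f_ n) (g_ n) @[n --> \oo] --> ip f g].
Proof.
move=> sf_ sg_ mf mg cf cg.
have [sf {}cf] := sqint_cvg sf_ mf cf.
have [sg {}cg] := sqint_cvg sg_ mg cg.
split => //; apply/cvgrPdist_le => e e0.
pose a n := Num.sqrt (ip (fun x => f_ n x - f x) (fun x => f_ n x - f x)).
pose b n := Num.sqrt (ip (fun x => g_ n x - g x) (fun x => g_ n x - g x)).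
have sF n := sqintB (sf_ n) sf; have sG n := sqintB (sg_ n) sg.
have key n : `|ip f g - ip (f_ n) (g_ n)| <=
    a n * b n + Num.sqrt (ip f f) * b n + a n * Num.sqrt (ip g g).
  have -> : ip f g - ip (f_ n) (g_ n) =
      - (ip (fun x => f_ n x - f x) (fun x => g_ n x - g x)
        + ip f (fun x => g_ n x - g x) + ip (fun x => f_ n x - f x) g).
    have -> : ip (f_ n) (g_ n) =
        ip (fun x => (f_ n x - f x) + f x) (fun x => (g_ n x - g x) + g x).
      by apply: eq_Rintegral => x _; rewrite !subrK.
    have ipDD F G : sqint F -> sqint G ->
        ip (fun x => F x + f x) (fun x => G x + g x) =
        ip F G + ip F g + (ip f G + ip f g).
      by move=> hF hG; have hGg := sqintD hG sg; rewrite ipDl// !ipDr.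
    by rewrite (ipDD _ _ (sF n) (sG n)); ring.
  rewrite normrN (le_trans (ler_normD _ _))// lerD//; last first.
    exact: cauchy_schwarz.
  by rewrite (le_trans (ler_normD _ _))// lerD//; exact: cauchy_schwarz.
have : (a n * b n + Num.sqrt (ip f f) * b n + a n * Num.sqrt (ip g g))
    @[n --> \oo] --> (0 * 0 + Num.sqrt (ip f f) * 0 + 0 * Num.sqrt (ip g g)).
  apply: cvgD; last by apply: cvgM => //; exact: cvg_cst.
  by apply: cvgD; apply: cvgM => //; exact: cvg_cst.
rewrite mul0r mulr0 mul0r !addr0 => /cvgrPdist_le/(_ e e0).
apply: filterS => n; rewrite sub0r normrN; apply: le_trans.
by apply: le_trans (key n) _; exact: ler_norm.
Qed.

End SquareIntegrable.

(** * Moments of the normal law *)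

Section NormalMoments.
Context (R : realType).
Local Notation mu := (@lebesgue_measure R).
Variable s : R.
Hypothesis s_gt0 : 0 < s.
Let s_neq0 : s != 0. Proof. by rewrite gt_eqF. Qed.
Local Notation q := (normal_pdf 0 s).

(** The Radon-Nikodym derivative of the normal law and the explicit density have the same integral
    over every measurable set, so they agree almost everywhere. *)
Lemma ge0_integral_normal_prob (f : R -> \bar R) :
  (forall x, 0 <= f x)%E -> measurable_fun setT f ->
  (\int[normal_prob 0 s]_x f x = \int[mu]_x (f x * (q x)%:E))%E.
Proof.
move=> f0 mf; have dom := @normal_prob_dominates R 0 s.
rewrite -(Radon_Nikodym_SigmaFinite.change_of_variables dom)//.
have mq : measurable_fun setT (fun x => (q x)%:E).
  by apply/measurable_EFinP; exact: measurable_normal_pdf.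
have iD := Radon_Nikodym_SigmaFinite.f_integrable dom.
apply: ae_eq_integral => //.
- by apply: emeasurable_funM => //; exact: measurable_int iD.
- exact: emeasurable_funM.
- apply: ae_eqe_mul2l; apply: integral_ae_eq => //.
  by move=> E _ mE; rewrite -Radon_Nikodym_SigmaFinite.f_integral.
Qed.

Lemma normal_pdf_sym x : q (- x) = q x.
Proof. by rewrite !normal_pdfE// /normal_fun !subr0 sqrrN. Qed.

(* An antiderivative of [(s^2 - x^2) q(x)] that vanishes at 0 and at infinity:
   the second moment is s^2 times the mass of [q]. *)
Let F (x : R) : R := x * q x * s ^+ 2.

Lemma is_derive_normal_pdf (x : R) : is_derive x 1 q (- (x / s ^+ 2) * q x).
Proof.
rewrite normal_pdfE//.
pose g (x : R) := - (x - 0) ^+ 2 / (s ^+ 2 *+ 2).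
have gE : g = (fun x : R => (- (s ^+ 2 *+ 2)^-1) * x ^+ 2).
  by apply/funext => y; rewrite /g subr0 mulrC mulrN mulNr.
have dg : is_derive x 1 g (- (x / s ^+ 2)).
  rewrite gE; apply: is_derive_eq.
  by rewrite /GRing.scale/= -mulr_natr; field.
pose p := normal_peak s.
have dF : is_derive x 1 (fun y => p * expR (g y)) (p * (expR (g x) * - (x / s ^+ 2))).
  apply: is_deriveZ; exact: is_derive1_comp.
apply: is_derive_eq dF _.
by rewrite /normal_fun /g /p; ring.
Qed.

Let F_derive (x : R) : is_derive x 1 F ((s ^+ 2 - x ^+ 2) * q x).
Proof.
have dq := is_derive_normal_pdf x.
apply: is_derive_eq.
rewrite /GRing.scale/=; by field.
Qed.

Let F_cvg0 : F x @[x --> +oo%R] --> (0 : R).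
Proof.
set p := normal_peak s; have p0 : 0 <= p := normal_peak_ge0 s.
pose v := s ^+ 2; have v0 : 0 < v by rewrite exprn_gt0.
apply: (@squeeze_cvgr _ _ _ _ (fun=> 0) (fun x : R => p * v * (2 * v) * x^-1));
  last 2 first.
- exact: cvg_cst.
- rewrite -[X in _ --> X](mulr0 (p * v * (2 * v))).
  apply: cvgM; first exact: cvg_cst.
  apply/gtr0_cvgV0; [by near=> x; near: x; exact: nbhs_pinfty_gt|exact: cvg_id].
near=> x.
have x0 : 0 < x by near: x; exact: nbhs_pinfty_gt.
rewrite /F normal_pdfE// /normal_fun subr0 -/p -/v mulNr.
set e := expR _; have e0 : 0 < e by exact: expR_gt0.
(* With u = x^2 / (2 v), the bound u <= 1 + u <= e^u gives u e^(-u) <= 1; dividing by x then bounds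
   [F x] by a multiple of 1/x. *)
have h : x ^+ 2 * e <= 2 * v.
  rewrite -[2 * v]mulr1 -ler_pdivrMl ?mulr_gt0// mulrA.
  rewrite -[X in _ <= X](@expRxMexpNx_1 R (x ^+ 2 / (v *+ 2))) ler_pM2r//.
  rewrite -mulr_natl mulrC.
  apply: le_trans (expR_ge1Dx (x ^+ 2 / (v *+ 2))).
  by rewrite mulr1 mulr_natl lerDr.
apply/andP; split; first by rewrite !mulr_ge0// ltW.
rewrite ler_pdivlMr//.
have := ler_wpM2l (mulr_ge0 p0 (ltW v0)) h.
by congr (_ <= _); ring.
Unshelve. all: end_near. Qed.

Let q_ge0 x : 0 <= q x. Proof. exact: normal_pdf_ge0. Qed.
Let q_cont : continuous q. Proof. exact: continuous_normal_pdf. Qed.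
Let q_meas : measurable_fun setT q. Proof. exact: measurable_normal_pdf. Qed.

Let F_cont : continuous F.
Proof.
move=> x; apply/differentiable_continuous/derivable1_diffP.
by have [] := F_derive x.
Qed.

Let cvg_right (f : R -> R) (a : R) : continuous f -> f x @[x --> a^'+] --> f a.
Proof. by move=> cf; apply: cvg_at_right_filter; exact: cf. Qed.

Let cvg_left (f : R -> R) (a : R) : continuous f -> f x @[x --> a^'-] --> f a.
Proof. by move=> cf; apply: cvg_at_left_filter; exact: cf. Qed.

Let f_cont : continuous (fun x : R => (s ^+ 2 - x ^+ 2) * q x).
Proof.
move=> x; apply: cvgM; last exact: q_cont.
by apply: cvgB; [exact: cvg_cst|exact: sqr_continuous].
Qed.

Let inner_int : (\int[mu]_(x in `[0%R, s]) ((s ^+ 2 - x ^+ 2) * q x)%:E =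
  (F s)%:E)%E.
Proof.
rewrite (@continuous_FTC2 _ _ F)//.
- by rewrite /F !mul0r oppe0 adde0.
- exact: continuous_subspaceT.
- split; [by move=> x _; have [] := F_derive x|exact: cvg_right|exact: cvg_left].
- by move=> x _; rewrite derive1E; have [_ ->] := F_derive x.
Qed.

Let outer_int : (\int[mu]_(x in `[s, +oo[) ((x ^+ 2 - s ^+ 2) * q x)%:E =
  (F s)%:E)%E.
Proof.
rewrite (@ge0_continuous_FTC2y _ _ (fun x => - F x) s 0)//.
- by rewrite sub0e EFinN oppeK.
- move=> x sx; rewrite mulr_ge0// subr_ge0 ler_sqr ?nnegrE// ltW//.
  exact: lt_le_trans sx.
- apply: continuous_subspaceT => x; apply: cvgM; last exact: q_cont.
  by apply: cvgB; [exact: sqr_continuous|exact: cvg_cst].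
- by rewrite -[X in _ --> X]oppr0; exact: cvgN.
- by move=> x _; apply: derivableN; have [] := F_derive x.
- by apply: cvgN; exact: cvg_right.
- move=> x _; have dF := F_derive x.
  have dN : is_derive x 1 (fun x => - F x) ((x ^+ 2 - s ^+ 2) * q x).
    by apply: is_derive_eq (is_deriveN dF) _; ring.
  by rewrite derive1E; have [_ ->] := dN.
Qed.

Let meas_sqr_q : measurable_fun setT (fun x : R => x ^+ 2 * q x).
Proof. by apply: measurable_funM => //; exact: measurable_funX. Qed.

(* The half-line is split at [s], where [s^2 - x^2] changes sign, since the
   library's FTC on unbounded intervals is for nonnegative integrands. *)
Let half_line_sqr : (\int[mu]_(x in `[0%R, +oo[) (x ^+ 2 * q x)%:E =
  \int[mu]_(x in `[0%R, +oo[) (s ^+ 2 * q x)%:E)%E.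
Proof.
have meas_q : measurable_fun setT (fun x : R => s ^+ 2 * q x).
  exact: measurable_funM.
have split_at (f : R -> R) : measurable_fun setT f -> (forall x, 0 <= f x) ->
   (\int[mu]_(x in `[0%R, +oo[) (f x)%:E =
    \int[mu]_(x in `[0%R, s]) (f x)%:E + \int[mu]_(x in `[s, +oo[) (f x)%:E)%E.
  move=> mf f0; rewrite -integral_itv_obnd_cbnd; last first.
    exact/measurable_EFinP/measurable_funTS.
  rewrite (@itv_bndbnd_setU _ _ (BLeft 0) (BRight s) +oo%O) ?bnd_simp ?ltW//.
  rewrite ge0_integral_setU//=.
  - exact/measurable_EFinP/measurable_funTS.
  - by move=> x _; rewrite lee_fin.
  - rewrite disj_set2E; apply/eqP; rewrite -subset0 => x [] /=.
    by rewrite !in_itv/= andbT => /andP[_]; rewrite leNgt => /negP.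
rewrite !split_at//; last 2 first.
- by move=> x; rewrite mulr_ge0// sqr_ge0.
- by move=> x; rewrite mulr_ge0// sqr_ge0.
have mT (D : set R) f : measurable_fun setT f -> measurable_fun D (EFin \o f).
  by move=> mf; exact/measurable_EFinP/measurable_funTS.
(* The boundary value [F s] enters with x^2 q beyond [s] and with s^2 q before [s]; it therefore
   appears once on each side of the equation, and only a regrouping of the sum remains. *)
have -> : (\int[mu]_(x in `[s, +oo[) (x ^+ 2 * q x)%:E =
    \int[mu]_(x in `[s, +oo[) (s ^+ 2 * q x)%:E + (F s)%:E)%E.
  rewrite -outer_int -ge0_integralD//=.
  - by apply: eq_integral => x _; rewrite /= -EFinD -mulrDl subrKC.
  - by move=> x _; rewrite lee_fin mulr_ge0// sqr_ge0.
  - exact: mT.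
  - move=> x; rewrite in_itv/= andbT => sx; rewrite lee_fin mulr_ge0//.
    have x0 := le_trans (ltW s_gt0) sx.
    by rewrite subr_ge0 ler_sqr ?nnegrE// ltW.
  - apply: mT; apply: measurable_funM => //.
    by apply: measurable_funB => //; exact: measurable_funX.
have -> : (\int[mu]_(x in `[0%R, s]) (s ^+ 2 * q x)%:E =
    \int[mu]_(x in `[0%R, s]) (x ^+ 2 * q x)%:E + (F s)%:E)%E.
  rewrite -inner_int -ge0_integralD//=.
  - by apply: eq_integral => x _; rewrite /= -EFinD -mulrDl subrKC.
  - by move=> x _; rewrite lee_fin mulr_ge0// sqr_ge0.
  - exact: mT.
  - move=> x; rewrite in_itv/= => /andP[x0 xs]; rewrite lee_fin mulr_ge0//.
    by rewrite subr_ge0 ler_sqr ?nnegrE// ltW.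
  - apply: mT; apply: measurable_funM => //.
    by apply: measurable_funB => //; exact: measurable_funX.
by rewrite -addeA; congr (_ + _)%E; rewrite addeC.
Qed.

Lemma normal_second_moment :
  (\int[normal_prob 0 s]_x (x ^+ 2)%:E = (s ^+ 2)%:E)%E.
Proof.
rewrite ge0_integral_normal_prob; last 2 first.
- by move=> x; rewrite lee_fin sqr_ge0.
- by apply/measurable_EFinP; exact: measurable_funX.
have ge0set : [set x : R | 0 <= x] = `[0%R, +oo[%classic.
  by apply/seteqP; split => x/=; rewrite in_itv/= andbT.
under eq_integral do rewrite -EFinM.
rewrite (@ge0_symfun_integralT _ (fun x : R => x ^+ 2 * q x)).
- rewrite ge0set half_line_sqr -ge0set -(@ge0_symfun_integralT _ (fun x : R => s ^+ 2 * q x)).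
  + under eq_integral do rewrite EFinM.
    rewrite ge0_integralZl//.
    * by rewrite integral_normal_pdf mule1.
    * exact/measurable_EFinP.
    * by move=> x _; rewrite lee_fin.
    * by rewrite lee_fin sqr_ge0.
  + by move=> x; rewrite mulr_ge0// sqr_ge0.
  + by move=> x; apply: cvgM; [exact: cvg_cst|exact: q_cont].
  + by move=> x /=; rewrite normal_pdf_sym.
- by move=> x; rewrite mulr_ge0// sqr_ge0.
- by move=> x; apply: cvgM; [exact: sqr_continuous|exact: q_cont].
- by move=> x /=; rewrite normal_pdf_sym sqrrN.
Qed.

Let ge0_integral_opp (f : R -> \bar R) : (forall x, 0 <= f x)%E ->
  measurable_fun setT f -> (\int[mu]_x f (- x)%R = \int[mu]_x f x)%E.
Proof.
move=> f0 mf.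
have mN : measurable_fun setT (-%R : measurableTypeR R -> measurableTypeR R).
  exact: oppr_measurable.
transitivity (\int[pushforward mu (-%R : measurableTypeR R -> measurableTypeR R)]_x f x)%E.
  by rewrite ge0_integral_pushforward.
by apply: eq_measure_integral => A mA _; exact: lebesgue_measureN.
Qed.

(** The density is even, so the positive and negative parts of the identity have equal integrals.
    Were both infinite, [fine] would still send their difference to 0, so no integrability argument
    is made. *)
Lemma normal_first_moment : (\int[normal_prob 0 s]_x x = 0)%R.
Proof.
rewrite /Rintegral integralE.
have mE : measurable_fun setT (EFin : R -> \bar R).
  by apply/measurable_EFinP; exact: measurable_id.
suff -> : (\int[normal_prob 0 s]_x (EFin : R -> \bar R)^\- x =
           \int[normal_prob 0 s]_x (EFin : R -> \bar R)^\+ x)%E.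
  by case: (integral _ _ _) => [r||] //=; rewrite subrr.
rewrite !ge0_integral_normal_prob//; last 2 first.
- exact: measurable_funepos.
- exact: measurable_funeneg.
rewrite -[RHS]ge0_integral_opp; last 2 first.
- by move=> x; rewrite mule_ge0// lee_fin.
- by apply: emeasurable_funM; [exact: measurable_funepos|exact/measurable_EFinP].
by apply: eq_integral => x _; rewrite normal_pdf_sym funenegE funeposE EFinN.
Qed.

End NormalMoments.

(** * Independence and Brownian increments *)

Section ProductIntegral.
Context d1 d2 (T1 : measurableType d1) (T2 : measurableType d2) (R : realType).
Variables (m1 : {sigma_finite_measure set T1 -> \bar R})
  (m2 : {sigma_finite_measure set T2 -> \bar R}).
Variables (f : T1 -> R) (g : T2 -> R).

Lemma summable_tensor : summable_fun m1 f -> summable_fun m2 g ->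
  summable_fun (m1 \x m2)%E (fun x => f x.1 * g x.2) /\
  (\int[(m1 \x m2)%E]_x (f x.1 * g x.2) =
   (\int[m1]_x f x) * (\int[m2]_y g y))%R.
Proof.
move=> sf sg.
have mf := summable_measurable sf; have mg := summable_measurable sg.
have mfg : measurable_fun setT (fun x : T1 * T2 => (f x.1 * g x.2)%:E).
  apply/measurable_EFinP; apply: measurable_funM.
    exact: measurableT_comp mf measurable_fst.
  exact: measurableT_comp mg measurable_snd.
have sfg : summable_fun (m1 \x m2)%E (fun x => f x.1 * g x.2).
  apply/integrable12ltyP => //=.
  have -> : (fun x => \int[m2]_y `|(f x * g y)%:E|)%E =
      (fun x => `|(f x)%:E| * \int[m2]_y `|(g y)%:E|)%E.
    apply/funext => x; rewrite -ge0_integralZl//.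
    - by apply: eq_integral => y _; rewrite EFinM abseM.
    - by apply: measurableT_comp => //; exact/measurable_EFinP.
  rewrite ge0_integralZr//; last 2 first.
  - by apply: measurableT_comp => //; exact/measurable_EFinP.
  - exact: integral_ge0.
  have /integrableP[_ h1] := sf; have /integrableP[_ h2] := sg.
  by rewrite lte_mul_pinfty// ?ge0_fin_numE// integral_ge0.
split => //; rewrite /Rintegral -fineM; [|exact: integrable_fin_num..].
congr fine; rewrite -(integral12_prod_meas1 sfg).
transitivity (\int[m1]_x ((f x)%:E * \int[m2]_y (g y)%:E))%E.
  apply: eq_integral => x _; rewrite /fubini_F /= -(integralZl measurableT sg).
  by apply: eq_integral => y _; rewrite EFinM.
by rewrite -(fineK (integrable_fin_num measurableT sg)) integralZr.
Qed.

End ProductIntegral.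

(** * Products of independent random variables *)

Section Independence.
Context d (Om : measurableType d) (R : realType) (P : probability Om R).
Implicit Types U V : Om -> R.

Definition indep U V : Prop := forall A B : set R, measurable A -> measurable B ->
  P (U @^-1` A `&` V @^-1` B) = (P (U @^-1` A) * P (V @^-1` B))%E.

Lemma summable_cst (c : R) : summable_fun P (fun=> c).
Proof. exact: finite_measure_integrable_cst. Qed.

Lemma sqint_cst (c : R) : sqint P (fun=> c).
Proof. by split => //; exact: summable_cst. Qed.

Lemma sqint_summable U : sqint P U -> summable_fun P U.
Proof.
move=> [mU sU]; apply: summable_le mU _ (summableD (summable_cst 1) sU) => w.
rewrite ler_norml; apply/andP; split; nra.
Qed.

Lemma bounded_sqint U : measurable_fun setT U ->
  (exists M : R, forall w, `|U w| <= M) -> sqint P U.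
Proof.
move=> mU [M UM]; split => //.
apply: summable_le (summable_cst (M ^+ 2)) => [|w]; first exact: measurable_funX.
by rewrite normrX lerXn2r ?nnegrE// (le_trans _ (UM w)).
Qed.

(** The law of the pair agrees with the product of the two laws on rectangles, hence everywhere, and
    Fubini factors the integral of x y. *)
Lemma indep_mul U V : summable_fun P U -> summable_fun P V -> indep U V ->
  summable_fun P (fun w => U w * V w) /\
  (\int[P]_w (U w * V w) = (\int[P]_w U w) * (\int[P]_w V w))%R.
Proof.
move=> sU sV UV.
have mU := summable_measurable sU; have mV := summable_measurable sV.
pose U' : {mfun Om >-> R} := HB.pack U (isMeasurableFun.Build _ _ _ _ U mU).
pose V' : {mfun Om >-> R} := HB.pack V (isMeasurableFun.Build _ _ _ _ V mV).
have mUV : measurable_fun setT (fun w => (U w, V w)).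
  exact: measurable_fun_pair.
pose UV' : {mfun Om >-> (R * R)%type} :=
  HB.pack (fun w => (U w, V w)) (isMeasurableFun.Build _ _ _ _ _ mUV).
pose m1 := distribution P U'; pose m2 := distribution P V'.
have eq_prod A : measurable A -> distribution P UV' A = (m1 \x m2)%E A.
  by move=> mA; apply/esym/product_measure_unique.
have sm1 : summable_fun m1 (fun x : R => x).
  exact: (integrable_pushforward mU (@EFin_measurable R setT) sU measurableT).
have sm2 : summable_fun m2 (fun x : R => x).
  exact: (integrable_pushforward mV (@EFin_measurable R setT) sV measurableT).
have [im iE] := summable_tensor sm1 sm2.
have mmul := measurable_int _ im.
have sUV : summable_fun P (fun w => U w * V w).
  apply/integrableP; split.
    by apply/measurable_EFinP; exact: measurable_funM.
  have /integrableP[_] := im.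
  rewrite (eq_measure_integral (distribution P UV')); last first.
    by move=> A mA _; apply/esym/eq_prod.
  by rewrite ge0_integral_distribution//; exact: measurableT_comp.
split => //.
have E1 : (\int[m1]_x x = \int[P]_w U w)%R.
  by congr fine; rewrite integral_distribution//; exact: EFin_measurable.
have E2 : (\int[m2]_x x = \int[P]_w V w)%R.
  by congr fine; rewrite integral_distribution//; exact: EFin_measurable.
rewrite -E1 -E2 -[RHS]iE; congr fine.
transitivity (\int[distribution P UV']_x (x.1 * x.2)%:E)%E.
  by rewrite integral_distribution.
by apply: eq_measure_integral => A mA _; exact: eq_prod.
Qed.

End Independence.

(** * The augmented filtration and its independence of later increments *)

Section BrownianIncrements.
Context d (Om : measurableType d) (R : realType) (P : probability Om R).
Hypothesis P_complete : measure_is_complete P.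
Variables (D : nat) (W : 'I_D -> R -> Om -> R).
Hypothesis W_bm : brownian_motion P W.

Definition increment (k : 'I_D) (s t : R) (w : Om) : R := W k t w - W k s w.

(** Completeness of [P] is what turns the adjoined negligible sets into events. *)
Lemma augmented_measurable t A : augmented_filtration P W t A -> measurable A.
Proof.
apply; split; first exact: sigma_algebra_measurable.
move=> B [[k [s [C [/andP[s0 _] mC ->]]]]|]; last exact: P_complete.
by rewrite -[X in measurable X]setTI; exact: (bm_measurable W_bm k s0).
Qed.

Lemma augmented_mono s t : s <= t ->
  augmented_filtration P W s `<=` augmented_filtration P W t.
Proof.
move=> st; apply: sub_sigma_algebra2 => B [|nB]; last by right.
move=> [k [u [C [/andP[u0 us] mC ->]]]]; left; exists k, u, C; split => //.
by rewrite u0 (le_trans us).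
Qed.

(* [g_sigma_algebraType] closes its argument once more into a sigma-algebra,
   which [augmented_filtration] already is. *)
Lemma F_measurableE t U : F_measurable P W t U <->
  forall B, measurable B -> augmented_filtration P W t (U @^-1` B).
Proof.
have idE : <<s augmented_filtration P W t >> = augmented_filtration P W t.
  by apply: sigma_algebra_id; exact: smallest_sigma_algebra.
split=> [FU B mB|FU _ B mB]; last by rewrite setTI; apply: sub_sigma_algebra; exact: FU.
by rewrite -idE -[X in _ X]setTI; exact: (FU measurableT B mB).
Qed.

Lemma F_measurable_measurable t U : F_measurable P W t U ->
  measurable_fun setT U.
Proof.
move=> /F_measurableE FU _ B mB; rewrite setTI.
by apply: (@augmented_measurable t); exact: FU.
Qed.

Lemma F_measurable_le s t U : s <= t ->
  F_measurable P W s U -> F_measurable P W t U.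
Proof.
move=> st /F_measurableE FU; apply/F_measurableE => B mB.
by apply: (augmented_mono st); exact: FU.
Qed.

Lemma F_measurableM t U V : F_measurable P W t U -> F_measurable P W t V ->
  F_measurable P W t (fun w => U w * V w).
Proof. exact: measurable_funM. Qed.

Lemma W_F_measurable k (s t : R) : 0 <= s <= t -> F_measurable P W t (W k s).
Proof.
move=> st; apply/F_measurableE => B mB; apply: sub_sigma_algebra; left.
by exists k, s, B.
Qed.

Lemma increment_F_measurable k (s t u : R) : 0 <= s -> s <= t -> t <= u ->
  F_measurable P W u (increment k s t).
Proof.
move=> s0 st tu; apply: measurable_funB; apply: W_F_measurable.
- by rewrite (le_trans s0 st) tu.
- by rewrite s0 (le_trans st tu).
Qed.

(** A pi-lambda argument carries independence over to the null sets. A generator in [past_events]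
    involves a single time and component, so the generators are not closed under intersection; the
    pi-system [G] is the sigma-algebra they generate, together with the negligible sets. *)
Lemma augmented_indep (s t : R) A E : 0 <= s < t ->
  augmented_filtration P W s A -> <<s increment_events W s t >> E ->
  P (A `&` E) = (P A * P E)%E.
Proof.
move=> st sA sE.
have mE : measurable E.
  apply: sE; split; first exact: sigma_algebra_measurable.
  move=> _ [k [B [mB ->]]]; case/andP: st => s0 st.
  rewrite -[X in measurable X]setTI.
  apply: measurable_funB => //; first exact: (bm_measurable W_bm k (le_trans s0 (ltW st))).
  exact: (bm_measurable W_bm k s0).
pose G := <<s past_events W s >> `|` [set N | P.-negligible N].
have GI : setI_closed G.
  move=> A1 A2 [s1|n1] [s2|n2].
  - left.
    exact: (@measurableI _ (g_sigma_algebraType (past_events W s)) A1 A2).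
  - by right; apply: negligibleS n2; exact: subIsetr.
  - by right; apply: negligibleS n1; exact: subIsetl.
  - by right; apply: negligibleS n1; exact: subIsetl.
pose L := [set B | measurable B /\ P (B `&` E) = (P B * P E)%E].
have LG : G `<=` L.
  move=> B [sB|nB].
    have mB : measurable B.
      apply: (@augmented_measurable s).
      by apply: sub_sigma_algebra2 sB; exact: subsetUl.
    by split => //; exact: (bm_independent W_bm st sB sE).
  have mB := P_complete nB; split => //.
  rewrite !(measure_negligible _ nB)// ?mul0e//.
  apply: measure_negligible; first exact: measurableI.
  by apply: negligibleS nB; exact: subIsetl.
have dL : dynkin L.
  split.
  - by split => //; rewrite setTI probability_setT mul1e.
  - move=> B [mB PB]; split; first exact: measurableC.
    rewrite setIC -setDE measureD ?ltey_eq ?fin_num_measure//.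
    have PB' : P (E `&` B) = (P B * P E)%E by rewrite setIC PB.
    rewrite [X in (_ - X)%E]PB' probability_setC//.
    have key (a b : \bar R) : a \is a fin_num -> b \is a fin_num ->
        (a - b * a = (1 - b) * a)%E.
      by move: a b => [a||] [b||]//= _ _; congr EFin; ring.
    by apply: key; exact: fin_num_measure.
  - move=> B tB mB; split.
      by apply: bigcupT_measurable => k; exact: (mB k).1.
    rewrite setI_bigcupl measure_bigcup//; last 2 first.
    - by move=> k _; apply: measurableI => //; exact: (mB k).1.
    - by apply: trivIset_setIr.
    rewrite [in RHS]measure_bigcup//; last by move=> k _; exact: (mB k).1.
    rewrite muleC -(fineK (fin_num_measure P _ mE)) -nneseriesZl//.
    apply: eq_eseriesr => k _; rewrite fineK ?fin_num_measure// muleC.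
    exact: (mB k).2.
have : <<s G >> `<=` L.
  rewrite -setI_closed_g_dynkin_g_sigma_algebra//.
  by move=> B; apply.
move=> /(_ A); case=> //.
have sub : past_events W s `|` [set N | P.-negligible N] `<=` G.
  by move=> B [sB|nB]; [left; exact: sub_gen_smallest|right].
exact: (sub_sigma_algebra2 sub).
Qed.

End BrownianIncrements.

(** * First and second moments of increments, weighted by past variables *)

Section IncrementMoments.
Context d (Om : measurableType d) (R : realType) (P : probability Om R).
Hypothesis P_complete : measure_is_complete P.
Variables (D : nat) (W : 'I_D -> R -> Om -> R).
Hypothesis W_bm : brownian_motion P W.
Local Notation increment := (increment W).
Local Notation F_meas := (F_measurable P W).

Lemma increment_measurable k (s t : R) : 0 <= s <= t ->
  measurable_fun setT (increment k s t).
Proof.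
move=> /andP[s0 st]; apply: measurable_funB.
  exact: (bm_measurable W_bm k (le_trans s0 st)).
exact: (bm_measurable W_bm k s0).
Qed.

(** A marginal of [bm_gaussian]: the boxes [E] are the whole line in every component other than [k]
    and [l], where the normal law has mass 1. *)
Lemma increment_joint_law k l (s t : R) (A B : set R) : 0 <= s < t -> k != l ->
  measurable A -> measurable B ->
  P (increment k s t @^-1` A `&` increment l s t @^-1` B) =
  (normal_prob 0 (Num.sqrt (t - s)) A * normal_prob 0 (Num.sqrt (t - s)) B)%E.
Proof.
move=> st kl mA mB.
pose E (j : 'I_D) : set R := if j == k then A else if j == l then B else setT.
have mE j : measurable (E j) by rewrite /E; case: ifP => // _; case: ifP.
have := bm_gaussian W_bm st mE.
have : normal_prob 0 (Num.sqrt (t - s)) setT = 1%E by exact: probability_setT.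
move: (normal_prob _ _) => N NT.
have lk : l != k by rewrite eq_sym.
rewrite (bigD1 k)// (bigD1 l)// big1; last first.
  by move=> j /andP[jk jl]; rewrite /E (negbTE jk) (negbTE jl).
have Ek : E k = A by rewrite /E eqxx.
have El : E l = B by rewrite /E eqxx (negbTE lk).
rewrite /= mule1 Ek El => <-; congr (P _).
apply/seteqP; split=> [w [kA lB] j|w Ew].
  by rewrite /E; case: eqP => [->//|_]; case: eqP => [->|].
by split; [have := Ew k; rewrite Ek|have := Ew l; rewrite El].
Qed.

Lemma increment_law k (s t : R) (A : set R) : 0 <= s < t -> measurable A ->
  P (increment k s t @^-1` A) = normal_prob 0 (Num.sqrt (t - s)) A.
Proof.
move=> st mA.
pose E (j : 'I_D) : set R := if j == k then A else setT.
have mE j : measurable (E j) by rewrite /E; case: ifP.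
have := bm_gaussian W_bm st mE.
have : normal_prob 0 (Num.sqrt (t - s)) setT = 1%E by exact: probability_setT.
move: (normal_prob _ _) => N NT.
rewrite (bigD1 k)// big1; last first.
  by move=> j jk; rewrite /E (negbTE jk).
have Ek : E k = A by rewrite /E eqxx.
rewrite /= mule1 Ek => <-; congr (P _).
apply/seteqP; split=> [w kA j|w /(_ k)]; last by rewrite Ek.
by rewrite /E; case: eqP => [->|].
Qed.

Lemma increment_indep k l (s t : R) : 0 <= s < t -> k != l ->
  indep P (increment k s t) (increment l s t).
Proof.
move=> st kl A B mA mB.
by rewrite increment_joint_law// !increment_law.
Qed.

Lemma F_indep_increments (s t : R) U V : 0 <= s < t -> F_meas s U ->
  measurable_fun setT (V : g_sigma_algebraType (increment_events W s t) -> R) ->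
  indep P U V.
Proof.
move=> st /F_measurableE FU mV A B mA mB.
apply: (augmented_indep P_complete W_bm st); first exact: FU.
by rewrite -[X in <<s _ >> X]setTI; exact: (mV measurableT B mB).
Qed.

Lemma increment_events_measurable k (s t : R) :
  measurable_fun setT
    (increment k s t : g_sigma_algebraType (increment_events W s t) -> R).
Proof.
by move=> _ B mB; rewrite setTI; apply: sub_sigma_algebra; exists k, B.
Qed.

Section positive_length.
Variables (s t : R).
Hypothesis st : 0 <= s < t.
Let sle : 0 <= s <= t. Proof. by case/andP: st => -> /ltW. Qed.
Let sigma_gt0 : 0 < Num.sqrt (t - s).
Proof. by rewrite sqrtr_gt0 subr_gt0; case/andP: st. Qed.

Lemma increment_sqr k :
  sqint P (increment k s t) /\ ip P (increment k s t) (increment k s t) = t - s.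
Proof.
have mI := increment_measurable k sle.
have E2 : (\int[P]_w ((increment k s t w) ^+ 2)%:E = (t - s)%:E)%E.
  pose V : {mfun Om >-> measurableTypeR R} := HB.pack
    (increment k s t : Om -> measurableTypeR R)
    (@isMeasurableFun.Build _ _ Om (measurableTypeR R) _ mI).
  have mX : measurable_fun setT (fun x : R => (x ^+ 2)%:E).
    by apply/measurable_EFinP; exact: measurable_funX.
  have X0 (x : R) : (0 <= (x ^+ 2)%:E)%E by rewrite lee_fin sqr_ge0.
  rewrite -(@ge0_integral_distribution _ _ _ _ _ P V _ mX X0).
  transitivity (\int[normal_prob 0 (Num.sqrt (t - s))]_x (x ^+ 2)%:E)%E.
    by apply: eq_measure_integral => A mA _; exact: increment_law.
  rewrite normal_second_moment// sqr_sqrtr// subr_ge0.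
  by case/andP: sle.
have sI : sqint P (increment k s t) by apply: sqint_lty => //; rewrite E2 ltry.
by split => //; have := ip_sqr sI; rewrite E2 => -[].
Qed.

Lemma increment_mean k : (\int[P]_w increment k s t w = 0)%R.
Proof.
have mI := increment_measurable k sle.
have sI := sqint_summable (increment_sqr k).1.
pose V : {mfun Om >-> measurableTypeR R} := HB.pack
  (increment k s t : Om -> measurableTypeR R)
  (@isMeasurableFun.Build _ _ Om (measurableTypeR R) _ mI).
rewrite /Rintegral.
rewrite -(@integral_distribution _ _ _ _ _ P V _ (@EFin_measurable R setT) sI).
transitivity (\int[normal_prob 0 (Num.sqrt (t - s))]_x x)%R.
  by congr fine; apply: eq_measure_integral => A mA _; exact: increment_law.
exact: normal_first_moment.
Qed.

Lemma increment_covariance k l :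
  ip P (increment k s t) (increment l s t) = (k == l)%:R * (t - s).
Proof.
have [->|kl] := eqVneq k l; first by rewrite mul1r; exact: (increment_sqr l).2.
rewrite /ip mul0r.
rewrite (indep_mul _ _ (increment_indep st kl)).2 ?increment_mean ?mul0r//.
- exact: sqint_summable (increment_sqr k).1.
- exact: sqint_summable (increment_sqr l).1.
Qed.

End positive_length.

Lemma increment_ss k (s : R) w : increment k s s w = 0.
Proof. by rewrite /increment subrr. Qed.

Lemma increment_sqint k (s t : R) : 0 <= s <= t -> sqint P (increment k s t).
Proof.
move=> /andP[s0]; rewrite le_eqVlt => /predU1P[<-|st].
  by apply: eq_sqint (sqint_cst P 0) => w; rewrite increment_ss.
by apply: (increment_sqr _ k).1; rewrite s0.
Qed.

Lemma F_increment U k (s t : R) : 0 <= s <= t -> F_meas s U ->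
  summable_fun P U ->
  summable_fun P (fun w => U w * increment k s t w) /\
  (\int[P]_w (U w * increment k s t w) = 0)%R.
Proof.
move=> /andP[s0]; rewrite le_eqVlt => /predU1P[<- FU sU|st FU sU].
  split; first by apply: eq_summable (summable0 P) => w; rewrite increment_ss mulr0.
  by under eq_Rintegral do rewrite increment_ss mulr0; rewrite /Rintegral integral0.
have st' : 0 <= s < t by rewrite s0.
have [] := indep_mul sU (sqint_summable (increment_sqr st' k).1)
  (F_indep_increments st' FU (@increment_events_measurable k s t)).
by rewrite increment_mean// mulr0.
Qed.

Lemma F_increment2 U k l (s t : R) : 0 <= s <= t -> F_meas s U ->
  summable_fun P U ->
  summable_fun P (fun w => U w * (increment k s t w * increment l s t w)) /\
  (\int[P]_w (U w * (increment k s t w * increment l s t w)) =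
     (k == l)%:R * (t - s) * \int[P]_w U w)%R.
Proof.
move=> /andP[s0]; rewrite le_eqVlt => /predU1P[<- FU sU|st FU sU].
  split.
    by apply: eq_summable (summable0 P) => w; rewrite increment_ss mul0r mulr0.
  under eq_Rintegral do rewrite increment_ss mul0r mulr0.
  by rewrite /Rintegral integral0 subrr mulr0 mul0r.
have st' : 0 <= s < t by rewrite s0.
have [] := indep_mul sU (sqint_mul (increment_sqr st' k).1 (increment_sqr st' l).1)
  (F_indep_increments st' FU
    (measurable_funM (@increment_events_measurable k s t)
       (@increment_events_measurable l s t))).
by move=> ? ->; split => //; rewrite mulrC -increment_covariance.
Qed.

End IncrementMoments.

(** * The Ito integral of simple processes *)

Section SimpleIsometry.
Context d (Om : measurableType d) (R : realType) (P : probability Om R).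
Hypothesis P_complete : measure_is_complete P.
Variables (D : nat) (W : 'I_D -> R -> Om -> R).
Hypothesis W_bm : brownian_motion P W.
Local Notation increment := (increment W).
Local Notation F_meas := (F_measurable P W).
Local Notation mu := (@lebesgue_measure R).
Local Notation Q := (P \x mu)%E.
Implicit Types U V f : Om -> R.

(** The class of the coefficients of simple processes. Boundedness keeps a product of coefficients
    integrable against a product of two increments. *)
Definition bounded_past (t : R) U : Prop :=
  F_meas t U /\ exists M : R, forall w, `|U w| <= M.

Lemma bounded_past_le (s t : R) U : s <= t ->
  bounded_past s U -> bounded_past t U.
Proof. by move=> st [FU bU]; split => //; exact: F_measurable_le FU. Qed.

Lemma bounded_pastM (t : R) U V : bounded_past t U -> bounded_past t V ->
  bounded_past t (fun w => U w * V w).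
Proof.
move=> [FU [M UM]] [FV [N VN]]; split; first exact: F_measurableM.
by exists (M * N) => w; rewrite normrM ler_pM.
Qed.

Lemma bounded_past_summableM (t : R) U f : bounded_past t U -> summable_fun P f ->
  summable_fun P (fun w => U w * f w).
Proof.
move=> [FU [M UM]] sf.
apply: summable_le (summableZ M (summable_norm sf)) => [|w].
  apply: measurable_funM; last exact: summable_measurable sf.
  exact: F_measurable_measurable FU.
by rewrite normrM ler_wpM2r.
Qed.

Lemma bounded_past_sqint (t : R) U : bounded_past t U -> sqint P U.
Proof.
by move=> [FU bU]; apply: bounded_sqint => //; exact: F_measurable_measurable FU.
Qed.

Lemma bounded_past_sqintM (t : R) U f : bounded_past t U -> sqint P f ->
  sqint P (fun w => U w * f w).
Proof.
move=> bU [mf sf]; split.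
  by apply: measurable_funM => //; exact: (bounded_past_sqint bU).1.
have := bounded_past_summableM (bounded_pastM bU bU) sf.
by apply: eq_summable => w; rewrite exprMn expr2.
Qed.

Lemma increment_split k (s t u : R) w :
  increment k s u w = increment k s t w + increment k t u w.
Proof. by rewrite addrC addrA subrK. Qed.

Let summable3 U (s a b c e : R) k l : bounded_past s U -> 0 <= a <= b ->
  0 <= c <= e ->
  summable_fun P (fun w => U w * (increment k a b w * increment l c e w)).
Proof.
move=> bU ab ce; apply: bounded_past_summableM bU _.
by apply: sqint_mul; exact: increment_sqint.
Qed.

(** At time [c] both [U] and the earlier increment are known, so the later increment meets a past
    factor and has mean zero against it. *)
Lemma disjoint_increments U k l (a b c e : R) : 0 <= a <= b -> b <= c <= e ->
  bounded_past c U ->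
  (\int[P]_w (U w * (increment k a b w * increment l c e w)) = 0)%R.
Proof.
move=> ab bce bU; have [a0 ab'] := andP ab; have [bc ce] := andP bce.
have ce' : 0 <= c <= e by rewrite ce andbT (le_trans a0)// (le_trans ab').
under eq_Rintegral do rewrite mulrA.
apply: (F_increment P_complete W_bm _ ce' _ _).2.
- apply: F_measurableM; first exact: bU.1.
  exact: increment_F_measurable.
- apply: bounded_past_summableM bU _.
  by apply: sqint_summable; exact: increment_sqint.
Qed.

(** The longer increment is split at [b]: the part after [b] is orthogonal to all that precedes, and
    the part before it spans the same interval as the other factor. *)
Let common_start_le U k l (a b e : R) : 0 <= a -> a <= b <= e ->
  bounded_past a U ->
  (\int[P]_w (U w * (increment k a b w * increment l a e w)) =
   (k == l)%:R * (b - a) * \int[P]_w U w)%R.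
Proof.
move=> a0 /andP[ab be] bU.
have ab0 : 0 <= a <= b by rewrite a0.
have be0 : 0 <= b <= e by rewrite be andbT (le_trans a0).
under eq_Rintegral do rewrite (increment_split l a b e) mulrDr mulrDr.
rewrite RintegralD_summable; [|exact: (summable3 _ _ bU)..].
rewrite (disjoint_increments _ _ ab0 _ (bounded_past_le ab bU)) ?lexx// addr0.
apply: (F_increment2 P_complete W_bm _ _ ab0 bU.1 _).2.
exact: sqint_summable (bounded_past_sqint bU).
Qed.

Lemma common_start U k l (a b e : R) : 0 <= a -> a <= b -> a <= e ->
  bounded_past a U ->
  (\int[P]_w (U w * (increment k a b w * increment l a e w)) =
   (k == l)%:R * (Num.min b e - a) * \int[P]_w U w)%R.
Proof.
move=> a0 ab ae bU; have [be|/ltW eb] := leP b e.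
  by rewrite common_start_le// ab.
under eq_Rintegral do rewrite (mulrC (increment k _ _ _)).
by rewrite common_start_le// 1?eq_sym// ae.
Qed.

(** The length of the intersection of []a, b]] and []c, e]]; the outer maximum covers disjoint
    intervals. *)
Definition overlap (a b c e : R) : R :=
  Num.max 0 (Num.min b e - Num.max a c).

Let increments_cov_le U k l (a b c e : R) : 0 <= a <= b -> c <= e -> a <= c ->
  bounded_past c U ->
  (\int[P]_w (U w * (increment k a b w * increment l c e w)) =
   (k == l)%:R * overlap a b c e * \int[P]_w U w)%R.
Proof.
move=> /andP[a0 ab] ce ac bU; rewrite /overlap (max_idPr ac).
have c0 : 0 <= c := le_trans a0 ac.
have [bc|/ltW cb] := leP b c.
  rewrite (disjoint_increments _ _ _ _ bU) ?a0 ?bc//.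
  have -> : Num.max 0 (Num.min b e - c) = 0.
    by apply/max_idPl; rewrite subr_le0 ge_min bc.
  by rewrite mulr0 mul0r.
(* [U] is known only at the later left endpoint [c], so the other increment is cut there: its first
   part contributes 0 and its second part starts at [c]. *)
under eq_Rintegral do rewrite (increment_split k a c b) mulrDl mulrDr.
rewrite RintegralD_summable; last 2 first.
- by apply: (summable3 _ _ bU); rewrite ?a0 ?c0.
- by apply: (summable3 _ _ bU); rewrite ?c0.
rewrite (disjoint_increments _ _ _ _ bU) ?a0 ?lexx// add0r common_start//.
by congr (_ * _ * _); apply/esym/max_idPr; rewrite subr_ge0 le_min cb.
Qed.

Lemma increments_cov U k l (a b c e : R) : 0 <= a <= b -> 0 <= c <= e ->
  bounded_past (Num.max a c) U ->
  (\int[P]_w (U w * (increment k a b w * increment l c e w)) =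
   (k == l)%:R * overlap a b c e * \int[P]_w U w)%R.
Proof.
move=> ab ce bU; have [ac|/ltW ca] := leP a c.
  by apply: increments_cov_le => //; [case/andP: ce|rewrite (max_idPr ac) in bU].
under eq_Rintegral do rewrite (mulrC (increment k _ _ _)).
rewrite increments_cov_le//; last 2 first.
- by case/andP: ab.
- by rewrite (max_idPl ca) in bU.
by rewrite eq_sym /overlap (minC e) (maxC c).
Qed.

Implicit Types H G : simple_process P W.

Lemma sp_bounded_past H i : bounded_past (sp_lo (s := H) i) (sp_coef (s := H) i).
Proof. by split; [exact: sp_adapted|exact: sp_bounded]. Qed.

Lemma simple_integral_sqint k H : sqint P (simple_integral k H).
Proof.
apply: sqint_sum => i _.
apply: (bounded_past_sqintM (sp_bounded_past i)).
by apply: increment_sqint => //; exact: sp_itv.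
Qed.

Definition simple_fun H (x : Om * measurableTypeR R) : R := simple_value H x.2 x.1.

Lemma lebesgue_itv_overlap (a b c e : R) :
  summable_fun mu (fun x => \1_(`]a, b]%classic) x * \1_(`]c, e]%classic) x) /\
  (\int[mu]_x (\1_(`]a, b]%classic) x * \1_(`]c, e]%classic) x) =
   overlap a b c e)%R.
Proof.
have E : (fun x : R => \1_(`]a, b]%classic) x * \1_(`]c, e]%classic) x : R) =
    \1_(`]Num.max a c, Num.min b e]%classic).
  apply/funext => x; rewrite !indicE !mem_setE !in_itv/= -natrM mulnb.
  by rewrite gt_max le_min andbACA.
have L : mu `]Num.max a c, Num.min b e]%classic = (overlap a b c e)%:E.
  rewrite lebesgue_measure_itv/= lte_fin /overlap.
  case: ltP => h.
    by rewrite -EFinB; congr EFin; apply/esym/max_idPr; rewrite subr_ge0 ltW.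
  by congr EFin; apply/esym/max_idPl; rewrite subr_le0.
rewrite E; split; first exact: integrable_indic_itv.
transitivity (fine (mu `]Num.max a c, Num.min b e]%classic)); last by rewrite L.
by congr fine; rewrite integral_indic// setIT.
Qed.

Let piece (U : Om -> R) (a b : R) (x : Om * measurableTypeR R) : R :=
  U x.1 * \1_(`]a, b]%classic) x.2.

Let piece_mul U V (s t a b c e : R) : bounded_past s U -> bounded_past t V ->
  summable_fun Q (fun x => piece U a b x * piece V c e x) /\
  ip Q (piece U a b) (piece V c e) = overlap a b c e * ip P U V.
Proof.
move=> bU bV.
have E x : (U x.1 * V x.1) * (\1_(`]a, b]%classic) x.2 * \1_(`]c, e]%classic) x.2)
    = piece U a b x * piece V c e x by rewrite mulrACA.
have [s2 i2] := lebesgue_itv_overlap a b c e.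
have sUV := sqint_mul (bounded_past_sqint bU) (bounded_past_sqint bV).
have [sT iT] := summable_tensor sUV s2.
split; first exact: eq_summable sT.
by rewrite /ip mulrC -i2 -iT; apply: eq_Rintegral => x _; rewrite E.
Qed.

Let piece_sqint U (s a b : R) : bounded_past s U -> sqint Q (piece U a b).
Proof.
move=> bU; split.
  apply: measurable_funM.
    exact: measurableT_comp (bounded_past_sqint bU).1 measurable_fst.
  by apply: measurableT_comp measurable_snd; exact: measurable_indic.
by apply: eq_summable (piece_mul a b a b bU bU).1 => x; rewrite expr2.
Qed.

Lemma simple_fun_sqint H : sqint Q (simple_fun H).
Proof.
by apply: sqint_sum => i _; exact: (piece_sqint _ _ (sp_bounded_past i)).
Qed.

(** Both sides are bilinear, and the identity holds for each pair of terms: the covariance of two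
    increments and the integral of the product of two indicators are governed by the same [overlap].
    No common partition has to be formed, and overlapping intervals within one process do no
    harm. *)
Lemma simple_isometry k l H G :
  ip P (simple_integral k H) (simple_integral l G) =
  (k == l)%:R * ip Q (simple_fun H) (simple_fun G).
Proof.
have sI k' H' i : sqint P (fun w => sp_coef (s := H') i w *
    increment k' (sp_lo (s := H') i) (sp_hi (s := H') i) w).
  apply: (bounded_past_sqintM (sp_bounded_past i)).
  by apply: increment_sqint => //; exact: sp_itv.
have sF H' i : sqint Q (piece (sp_coef (s := H') i) (sp_lo (s := H') i)
    (sp_hi (s := H') i)) := piece_sqint _ _ (sp_bounded_past i).
rewrite ip_suml; [|by move=> i _; exact: sI|exact: simple_integral_sqint].
rewrite [ip Q _ _]ip_suml; [|by move=> i _; exact: sF|exact: simple_fun_sqint].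
rewrite mulr_sumr; apply: eq_bigr => i _.
rewrite ip_sumr; [|by move=> j _; exact: sI|exact: sI].
rewrite ip_sumr; [|by move=> j _; exact: sF|exact: sF].
rewrite mulr_sumr; apply: eq_bigr => j _.
rewrite (piece_mul _ _ _ _ (sp_bounded_past i) (sp_bounded_past j)).2 mulrA.
rewrite /ip -increments_cov; [|exact: sp_itv..|].
- by apply: eq_Rintegral => w _; rewrite mulrACA.
- apply: bounded_pastM; apply: bounded_past_le (sp_bounded_past _).
  + by rewrite le_max lexx.
  + by rewrite le_max lexx orbT.
Qed.

End SimpleIsometry.

(** * The Ito integral *)

Section ItoIsometry.
Context d (Om : measurableType d) (R : realType) (P : probability Om R).
Hypothesis P_complete : measure_is_complete P.
Variables (D : nat) (W : 'I_D -> R -> Om -> R).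
Hypothesis W_bm : brownian_motion P W.
Local Notation increment := (increment W).
Local Notation F_meas := (F_measurable P W).
Local Notation mu := (@lebesgue_measure R).
Local Notation Q := (P \x mu)%E.
Local Notation halfline := (`[0, +oo[%classic : set R).
Implicit Types U V I J : Om -> R.
Implicit Types H G : simple_process P W.

(** Extension by zero outside [A], with the sample point now first, so that integrals over [A]
    become integrals over the whole product space. *)
Definition cut_off (A : set R) (f : R -> Om -> R) (x : Om * measurableTypeR R) : R :=
  \1_A x.2 * f x.2 x.1.

Lemma measurable_cut_off A f : measurable A ->
  measurable_fun (setT `*` A) (fun x : Om * R => f x.2 x.1) ->
  measurable_fun setT (cut_off A f).
Proof.
move=> mA mf.
have mTA : measurable (setT `*` A : set (Om * R)) by exact: measurableX.
have /(measurable_restrictT _ mTA) h := mf.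
apply: eq_measurable_fun h => x _.
rewrite /cut_off patchE indicE; case: x => w s /=.
have -> : ((w, s) \in setT `*` A) = (s \in A).
  by apply/idP/idP; rewrite !inE /=; [case|split].
by case: ifPn => _; rewrite ?mul1r ?mul0r.
Qed.

Lemma simple_value_lt0 H (s : R) w : s < 0 -> simple_value H s w = 0.
Proof.
move=> s0; rewrite /simple_value big1// => i _.
have /andP[lo0 _] := sp_itv i; rewrite indicE mem_setE in_itv/=.
by rewrite ltNge (le_trans (ltW s0) lo0) mulr0.
Qed.

Lemma integral_halfline (g : Om -> R -> R) :
  measurable_fun setT (fun x : Om * measurableTypeR R => g x.1 x.2) ->
  (forall w s, 0 <= g w s) -> (forall w s, s < 0 -> g w s = 0) ->
  (\int[P]_w \int[mu]_(s in halfline) (g w s)%:E = \int[Q]_x (g x.1 x.2)%:E)%E.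
Proof.
move=> mg g0 gneg.
have mg' : measurable_fun setT
    (fun x : Om * measurableTypeR R => (g x.1 x.2)%:E).
  exact/measurable_EFinP.
have g0' (x : Om * measurableTypeR R) : (0 <= (g x.1 x.2)%:E)%E.
  by rewrite lee_fin.
rewrite (fubini_tonelli1 (m1 := P) (m2 := mu) _ mg' g0').
apply: eq_integral => w _; rewrite /fubini_F/= integral_mkcond.
apply: eq_integral => s _; rewrite patchE mem_setE in_itv/= andbT.
by case: ifPn => //; rewrite -ltNge => s0; rewrite gneg.
Qed.

Lemma is_ito1_approx k A f I : measurable A -> A `<=` halfline ->
  is_ito1 P W k A f I ->
  [/\ measurable_fun setT (cut_off A f), measurable_fun setT I &
      exists H : nat -> simple_process P W,
        (\int[Q]_x ((simple_fun (H m) x - cut_off A f x) ^+ 2)%:E)%E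
          @[m --> \oo] --> 0%E /\
        (\int[P]_w ((simple_integral k (H m) w - I w) ^+ 2)%:E)%E
          @[m --> \oo] --> 0%E].
Proof.
move=> mA A0 [mf mI [H [cH cI]]].
have mc := measurable_cut_off mA mf.
split => //; exists H; split => //.
apply: cvg_trans cH; apply: near_eq_cvg; apply: nearW => m.
rewrite (integral_halfline
  (g := fun w s => (simple_value (H m) s w - \1_A s * f s w) ^+ 2))//.
- apply: measurable_funX; apply: measurable_funB => //.
  exact: (simple_fun_sqint P_complete W_bm (H m)).1.
- by move=> w s; rewrite sqr_ge0.
- move=> w s s0; rewrite simple_value_lt0// indicE memNset ?mul0r ?subrr ?expr0n//.
  by move=> /A0 /=; rewrite in_itv/= andbT leNgt s0.
Qed.

(** The isometry of simple processes passes to the limit by [ip_cvg] on both sides. With different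
    components the right-hand side is 0, which removes the cross terms between [W k] and [W l]. *)
Lemma ito_isometry k l A B f g I J :
  measurable A -> A `<=` halfline -> measurable B -> B `<=` halfline ->
  is_ito1 P W k A f I -> is_ito1 P W l B g J ->
  [/\ sqint P I, sqint P J, sqint Q (cut_off A f), sqint Q (cut_off B g) &
      ip P I J = (k == l)%:R * ip Q (cut_off A f) (cut_off B g)].
Proof.
move=> mA A0 mB B0 /(is_ito1_approx mA A0)[mf mI [H [cH cI]]].
move=> /(is_ito1_approx mB B0)[mg mJ [G [cG cJ]]].
have sI k' H' := simple_integral_sqint P_complete W_bm k' H'.
have sF H' := simple_fun_sqint P_complete W_bm H'.
have [sqf sqg cfg] := ip_cvg (fun m => sF (H m)) (fun m => sF (G m)) mf mg cH cG.
have [sqI sqJ cIJ] := ip_cvg (fun m => sI k (H m)) (fun m => sI l (G m)) mI mJ cI cJ.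
split => //.
apply: (cvg_unique (@norm_hausdorff _ R) cIJ).
have -> : (fun m => ip P (simple_integral k (H m)) (simple_integral l (G m))) =
    (fun m => (k == l)%:R * ip Q (simple_fun (H m)) (simple_fun (G m))).
  by apply/funext => m; exact: simple_isometry.
by apply: cvgM; [exact: cvg_cst|exact: cfg].
Qed.

(** * Stopping a simple process at time t *)

Section Truncation.
Variables (t : R) (H : simple_process P W).
Hypothesis t0 : 0 <= t.

(** If [sp_lo i] exceeds [t], the coefficient need not be known at the new left endpoint [t]; the
    truncated interval is then empty, so the coefficient can be replaced by 0. *)
Let coef i : Om -> R :=
  if sp_lo (s := H) i <= t then sp_coef (s := H) i else fun=> 0.

Let itv i : 0 <= Num.min (sp_lo (s := H) i) t <= Num.min (sp_hi (s := H) i) t.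
Proof.
have /andP[lo0 lohi] := sp_itv (s := H) i.
by rewrite !le_min lo0 t0 !ge_min lohi lexx orbT.
Qed.

Let adapted_coef i : F_meas (Num.min (sp_lo (s := H) i) t) (coef i).
Proof.
rewrite /coef; case: leP => _; last exact: measurable_cst.
exact: sp_adapted.
Qed.

Let bounded_coef i : exists M : R, forall w, `|coef i w| <= M.
Proof.
rewrite /coef; case: ifP => _; first exact: sp_bounded.
by exists 0 => w; rewrite normr0.
Qed.

Definition truncation : simple_process P W :=
  SimpleProcess itv adapted_coef bounded_coef.

Lemma truncation_value s w :
  simple_value truncation s w = if s <= t then simple_value H s w else 0.
Proof.
rewrite /simple_value -(fun_if (fun v => v)); case: ifPn => st; last first.
  rewrite big1// => i _ /=; rewrite indicE mem_setE in_itv/=.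
  by rewrite le_min (negbTE st) !andbF mulr0.
apply: eq_bigr => i _ /=; rewrite !indicE !mem_setE !in_itv/= /coef.
rewrite le_min st andbT; case: (leP (sp_lo (s := H) i) t) => h; first by [].
by rewrite mul0r (ltNge _ s) (le_trans st (ltW h)) mulr0.
Qed.

Lemma truncation_integral k w : simple_integral k H w =
  simple_integral k truncation w +
  \sum_i sp_coef (s := H) i w *
    increment k (Num.max (sp_lo (s := H) i) t) (Num.max (sp_hi (s := H) i) t) w.
Proof.
rewrite /simple_integral -big_split/=; apply: eq_bigr => i _.
have /andP[_ lohi] := sp_itv (s := H) i.
rewrite /coef; case: (leP (sp_lo (s := H) i) t) => h; last first.
  have h' := lt_le_trans h lohi.
  by rewrite mul0r add0r (max_idPl (ltW h')).
rewrite -mulrDr; congr (_ * _); rewrite /increment.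
by case: (leP (sp_hi (s := H) i) t) => h'; ring.
Qed.

(** What truncation removes consists of increments starting at [Num.max lo t], where both [U] and
    the coefficient are known, so each removed term has mean zero against [U]. *)
Lemma truncation_orthogonal U k : F_meas t U -> sqint P U ->
  ip P U (simple_integral k H) = ip P U (simple_integral k truncation).
Proof.
move=> FU sU.
have rest i : summable_fun P (fun w => (U w * sp_coef (s := H) i w) *
      increment k (Num.max (sp_lo (s := H) i) t) (Num.max (sp_hi (s := H) i) t) w) /\
    (\int[P]_w ((U w * sp_coef (s := H) i w) *
      increment k (Num.max (sp_lo (s := H) i) t) (Num.max (sp_hi (s := H) i) t) w)
     = 0)%R.
  have /andP[lo0 lohi] := sp_itv (s := H) i.
  apply: F_increment => //.
  - by rewrite le_max lo0/= ge_max !le_max lohi lexx orbT.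
  - apply: F_measurableM.
      by apply: (F_measurable_le _ FU); rewrite le_max lexx orbT.
    by apply: (F_measurable_le _ (sp_adapted (i := i))); rewrite le_max lexx.
  - have h := bounded_past_summableM P_complete W_bm (sp_bounded_past i)
      (sqint_summable sU).
    by apply: eq_summable h => w; rewrite mulrC.
rewrite /ip; under eq_Rintegral => w _.
  rewrite truncation_integral mulrDr mulr_sumr.
  under eq_bigr do rewrite mulrA.
  over.
rewrite RintegralD_summable.
- rewrite Rintegral_sum; last by move=> i _; exact: (rest i).1.
  by rewrite big1 ?addr0// => i _; exact: (rest i).2.
- exact: sqint_mul sU (simple_integral_sqint P_complete W_bm _ _).
- by apply: summable_sum => i _; exact: (rest i).1.
Qed.

End Truncation.

(* The simple processes approximating an integrand on [t, oo) need not vanish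
   before [t]; their truncations at [t] tend to 0 in L^2, and what is left only
   involves increments after [t]. *)
Lemma ito_orthogonal_past k A f I U (t : R) : 0 <= t -> measurable A ->
  A `<=` `[t, +oo[%classic -> is_ito1 P W k A f I ->
  F_meas t U -> sqint P U -> ip P U I = 0.
Proof.
move=> t0 mA At itoI FU sU.
have A0 : A `<=` halfline.
  by move=> s /At /=; rewrite !in_itv/= !andbT; exact: le_trans.
have [mf mI [H [cH cI]]] := is_ito1_approx mA A0 itoI.
pose T m := truncation (H m) t0.
have sI k' H' := simple_integral_sqint P_complete W_bm k' H'.
have sF H' := simple_fun_sqint P_complete W_bm H'.
(* By the isometry this is the squared L^2 norm of the truncated process, which is at most the
   squared distance from [H m] to [cut_off A f], since [cut_off A f] vanishes before [t]. *)
have cT : (\int[P]_w ((simple_integral k (T m) w - 0) ^+ 2)%:E)%E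
    @[m --> \oo] --> 0%E.
  apply: (squeeze_cvge _ (@cvg_cst _ (0%E : \bar R) _ _ _) cH).
  apply: nearW => m; rewrite integral_ge0/=; last first.
    by move=> w _; rewrite lee_fin sqr_ge0.
  under eq_integral do rewrite subr0.
  rewrite -ip_sqr// (simple_isometry P_complete W_bm) eqxx mul1r ip_sqr//.
  have mdiff : measurable_fun setT (fun x => simple_fun (H m) x - cut_off A f x).
    by apply: measurable_funB => //; exact: (sF _).1.
  have mE (h : Om * measurableTypeR R -> R) : measurable_fun setT h ->
      measurable_fun setT (fun x : Om * measurableTypeR R => ((h x) ^+ 2)%:E).
    by move=> mh; apply/measurable_EFinP; exact: measurable_funX.
  have E0 (h : Om * measurableTypeR R -> R) (x : Om * measurableTypeR R) :
      (0 <= ((h x) ^+ 2)%:E)%E.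
    by rewrite lee_fin sqr_ge0.
  rewrite (fubini_tonelli1 (m1 := P) (m2 := mu) _ (mE _ (sF (T m)).1) (E0 _)).
  rewrite (fubini_tonelli1 (m1 := P) (m2 := mu) _ (mE _ mdiff) (E0 _)).
  apply: ge0_le_integral => //.
  - by move=> w _; apply: integral_ge0 => s _; rewrite lee_fin sqr_ge0.
  - apply: measurable_fun_fubini_tonelli_F; last by move=> x; rewrite lee_fin sqr_ge0.
    by apply: mE; exact: (sF _).1.
  - apply: measurable_fun_fubini_tonelli_F; last by move=> x; rewrite lee_fin sqr_ge0.
    exact: mE.
  move=> w _; rewrite /fubini_F; apply: ae_ge0_le_integral => //.
  - by apply: (measurableT_comp (mE _ (sF (T m)).1)).
  - by move=> s _; rewrite lee_fin sqr_ge0.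
  - by apply: (measurableT_comp (mE _ mdiff)).
  (* The truncation keeps s = t, and [A] may contain [t] as well; the pointwise comparison holds for
     every other s. *)
  have nt : mu.-negligible [set t] by apply/negligibleP => //; exact: lebesgue_measure_set1.
  apply: negligibleS nt => s /= /not_implyP[_ h].
  apply: contrapT => st; apply: h; rewrite lee_fin /simple_fun truncation_value /cut_off/=.
  case: ifPn => h; last by rewrite expr0n/= sqr_ge0.
  rewrite indicE memNset ?mul0r ?subr0//.
  move=> /At /=; rewrite in_itv/= andbT => ts; apply: st; apply/eqP.
  by rewrite eq_le h.
pose zero : Om -> R := fun=> 0.
have m0 : measurable_fun setT zero by exact: measurable_cst.
have cU : (\int[P]_w ((U w - U w) ^+ 2)%:E)%E @[m --> \oo] --> 0%E.
  rewrite (_ : (\int[P]_w _)%E = 0%E); first exact: cvg_cst.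
  by apply: integral0_eq => w _; rewrite subrr expr0n.
have [_ _ cUI] := ip_cvg (fun=> sU) (fun m => sI k (H m)) sU.1 mI cU cI.
have [_ _ cUT] := ip_cvg (fun=> sU) (fun m => sI k (T m)) sU.1 m0 cU cT.
have -> : 0 = ip P U zero.
  by rewrite /ip; under eq_Rintegral do rewrite mulr0; rewrite /Rintegral integral0.
apply: (cvg_unique (@norm_hausdorff _ R) cUI).
have -> : (fun m => ip P U (simple_integral k (H m))) =
    (fun m => ip P U (simple_integral k (T m))).
  by apply/funext => m; exact: truncation_orthogonal.
exact: cUT.
Qed.

End ItoIsometry.

(** * Fubini for real-valued integrals *)

Section RealFubini.
Context d1 d2 (T1 : measurableType d1) (T2 : measurableType d2) (R : realType).
Variables (m1 : {sigma_finite_measure set T1 -> \bar R})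
  (m2 : {sigma_finite_measure set T2 -> \bar R}).
Variable f : T1 * T2 -> R.
Hypothesis sf : summable_fun (m1 \x m2)%E f.

Let fineP d (T : measurableType d) (m : {measure set T -> \bar R}) (F : T -> \bar R) :
  m.-integrable setT F -> summable_fun m (fine \o F) /\
  (\int[m]_x fine (F x) = fine (\int[m]_x F x))%R.
Proof.
move=> iF; have mF := measurable_int _ iF.
have mfine : measurable_fun setT (fun x => (fine (F x))%:E).
  by apply/measurable_EFinP; exact: measurableT_comp.
split.
  apply: le_integrable iF => // x _ /=.
  by case: (F x) => [r||] //=; rewrite normr0 leey.
congr fine; apply: ae_eq_integral => //.
apply: filterS (integrable_ae measurableT iF) => x Fx _.
by rewrite fineK// Fx.
Qed.

Lemma fubini_summable1 : {ae m1, forall x, summable_fun m2 (fun y => f (x, y))}.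
Proof. exact: (ae_integrable1 sf). Qed.

Lemma fubini_summable2 : {ae m2, forall y, summable_fun m1 (fun x => f (x, y))}.
Proof. exact: (ae_integrable2 sf). Qed.

Lemma fubini_Rintegral1 :
  summable_fun m1 (fun x => \int[m2]_y f (x, y))%R /\
  (\int[m1]_x (\int[m2]_y f (x, y)) = \int[(m1 \x m2)%E]_z f z)%R.
Proof.
have [s e] := fineP (integrable_fubini_F sf).
by split; [exact: s|rewrite [LHS]e (integral12_prod_meas1 sf)].
Qed.

Lemma fubini_Rintegral2 :
  summable_fun m2 (fun y => \int[m1]_x f (x, y))%R /\
  (\int[m2]_y (\int[m1]_x f (x, y)) = \int[(m1 \x m2)%E]_z f z)%R.
Proof.
have iG : m2.-integrable setT (fubini_G m1 (EFin \o f)).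
  apply/integrableP; split; first exact: (measurable_fubini_G sf).
  have mf := measurable_int _ sf.
  apply: le_lt_trans ((integrable21ltyP m1 m2 mf).1 sf).
  apply: ge0_le_integral => //.
  - by apply: measurableT_comp => //; exact: (measurable_fubini_G sf).
  - apply: (measurable_fun_fubini_tonelli_G (abse \o (EFin \o f))).
      exact: measurableT_comp.
    by move=> x; exact: abse_ge0.
  - by move=> y _; apply: le_abse_integral => //; exact: measurableT_comp.
have [s e] := fineP iG.
by split; [exact: s|rewrite [LHS]e (integral21_prod_meas1 sf)].
Qed.

End RealFubini.

Section RintegralScale.
Context d (T : measurableType d) (R : realType) (m : {measure set T -> \bar R}).

(** Integrability is assumed of [c * f]: for c = 0 both sides vanish whatever [f] is, otherwise [c]
    is divided out. In the use made of it, [c] contains a value of [Y] or [X] at one sample point,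
    possibly 0, and it is the product that Fubini shows to be integrable. *)
Lemma RintegralZ_summable (c : R) (f : T -> R) :
  summable_fun m (fun x => c * f x) ->
  (\int[m]_x (c * f x) = c * \int[m]_x f x)%R.
Proof.
move=> s; have [c0|c0] := eqVneq c 0.
  rewrite c0 mul0r; under eq_Rintegral do rewrite mul0r.
  by rewrite /Rintegral integral0.
apply: RintegralZl => //.
by apply: eq_summable (summableZ c^-1 s) => x; rewrite mulKf.
Qed.

Lemma ae_eq_Rintegral (f g : T -> R) : measurable_fun setT f ->
  measurable_fun setT g -> {ae m, forall x, f x = g x} ->
  (\int[m]_x f x = \int[m]_x g x)%R.
Proof.
move=> mf mg fg; congr fine; apply: ae_eq_integral => //; try exact/measurable_EFinP.
by apply: filterS fg => x -> _.
Qed.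

End RintegralScale.

(** * Reflection and translation invariance of Lebesgue measure *)

Section LebesgueInvariance.
Context (R : realType).
Local Notation mu := (@lebesgue_measure R).
Variable (c : R) (f : R -> \bar R).
Hypotheses (f0 : forall x, (0 <= f x)%E) (mf : measurable_fun setT f).

(** Lebesgue measure is determined by its values on the intervals []a, b]], and the preimage [[c -
    b, c - a[], though closed at the other end, has the same length. *)
Lemma ge0_integral_reflect : (\int[mu]_x f (c - x)%R = \int[mu]_x f x)%E.
Proof.
pose h : measurableTypeR R -> measurableTypeR R := fun x => c - x.
have mh : measurable_fun setT h by apply: measurable_funB.
transitivity (\int[pushforward mu h]_x f x)%E.
  by rewrite ge0_integral_pushforward.
pose h' : {mfun measurableTypeR R >-> measurableTypeR R} :=
  HB.pack h (isMeasurableFun.Build _ _ _ _ _ mh).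
suff key A : measurable A -> mu A = pushforward mu h' A.
  by apply: eq_measure_integral => A mA _; apply/esym/key.
apply: lebesgue_measure_unique => _ [[a b]] _ <-.
have E : pushforward mu h' `]a, b]%classic = mu `[c - b, c - a[%classic.
  congr (mu _); apply/seteqP; split => x; rewrite /h /= !in_itv/=;
    by rewrite !ltrBrDr !lerBlDr ![x + _]addrC => /andP[-> ->].
rewrite [RHS]E !lebesgue_measure_itv/= !lte_fin ltrD2l ltrN2.
by case: ifP => // _; rewrite -!EFinB; congr EFin; ring.
Qed.

Lemma ge0_integral_translate : (\int[mu]_x f (x - c)%R = \int[mu]_x f x)%E.
Proof.
pose h : measurableTypeR R -> measurableTypeR R := fun x => x - c.
have mh : measurable_fun setT h by apply: measurable_funB.
transitivity (\int[pushforward mu h]_x f x)%E.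
  by rewrite ge0_integral_pushforward.
pose h' : {mfun measurableTypeR R >-> measurableTypeR R} :=
  HB.pack h (isMeasurableFun.Build _ _ _ _ _ mh).
suff key A : measurable A -> mu A = pushforward mu h' A.
  by apply: eq_measure_integral => A mA _; apply/esym/key.
apply: lebesgue_measure_unique => _ [[a b]] _ <-.
have E : pushforward mu h' `]a, b]%classic = mu `]a + c, b + c]%classic.
  congr (mu _); apply/seteqP; split => x; rewrite /h /= !in_itv/=;
    by rewrite !ltrBrDr !lerBlDr.
rewrite [RHS]E !lebesgue_measure_itv/= !lte_fin ltrD2r.
by case: ifP => // _; rewrite -!EFinB; congr EFin; ring.
Qed.

End LebesgueInvariance.

(** * Two time variables *)

(* The library only registers [m1 \x m2] as sigma-finite for subprobabilities;
   this alias carries the general instance. *)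
Section SigmaFiniteProduct.
Local Open Scope ereal_scope.
Context d1 d2 (T1 : measurableType d1) (T2 : measurableType d2) (R : realType).
Variables (m1 : {sigma_finite_measure set T1 -> \bar R})
  (m2 : {sigma_finite_measure set T2 -> \bar R}).

Definition tensor : set (T1 * T2) -> \bar R := m1 \x m2.

HB.instance Definition _ := Measure.on tensor.

Let tensor_sigma_finite : sigma_finite setT tensor.
Proof.
have /sigma_finiteP[F [FT ndF Foo]] := sigma_finiteT m1.
have /sigma_finiteP[G [GT ndG Goo]] := sigma_finiteT m2.
exists (fun n => F n `*` G n) => [|n].
  apply/esym; rewrite -subTset => -[x y] _.
  have : [set: T1] x by []. rewrite FT => -[i _ Fx].
  have : [set: T2] y by []. rewrite GT => -[j _ Gy].
  exists (maxn i j) => //; split.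
    by move: x Fx; apply/subsetPset/ndF/leq_maxl.
  by move: y Gy; apply/subsetPset/ndG/leq_maxr.
have [mF Fn] := Foo n; have [mG Gn] := Goo n.
split; first exact: measurableX.
by rewrite /tensor product_measure1E// lte_mul_pinfty// ge0_fin_numE.
Qed.

HB.instance Definition _ :=
  Measure_isSigmaFinite.Build _ _ _ tensor tensor_sigma_finite.

End SigmaFiniteProduct.

(** * Fixing one of two times *)

Section TimeSlices.
Context d (Om : measurableType d) (R : realType) (P : probability Om R).
Local Notation mu := (@lebesgue_measure R).
Local Notation RR := (measurableTypeR R).
Local Notation Q := (P \x mu)%E.
Local Notation S := (P \x tensor mu mu)%E.

(** The two regroupings bring the time to be fixed to the front, the first time for [slot1] and the
    second for [slot2], and leave the other time paired with the sample point. *)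
Let slot1 (x : RR * (Om * RR)) : Om * (RR * RR) := (x.2.1, (x.1, x.2.2)).
Let slot2 (x : RR * (Om * RR)) : Om * (RR * RR) := (x.2.1, (x.2.2, x.1)).

Let measurable_slot1 : measurable_fun setT slot1.
Proof.
apply: measurable_fun_pair; first exact: measurableT_comp.
by apply: measurable_fun_pair => //; exact: measurableT_comp.
Qed.

Let measurable_slot2 : measurable_fun setT slot2.
Proof.
apply: measurable_fun_pair; first exact: measurableT_comp.
by apply: measurable_fun_pair => //; exact: measurableT_comp.
Qed.

Section nonnegative.
Variable f : Om * (RR * RR) -> \bar R.
Hypotheses (f0 : forall x, (0 <= f x)%E) (mf : measurable_fun setT f).

Let mh : measurable_fun setT (fun u : RR * RR => \int[P]_w f (w, u))%E.
Proof. exact: (measurable_fun_fubini_tonelli_G f mf f0). Qed.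

Let h0 (u : RR * RR) : (0 <= \int[P]_w f (w, u))%E.
Proof. by apply: integral_ge0 => w _; exact: f0. Qed.

(** By Tonelli both sides reduce to the iterated integral with the sample point innermost and the
    fixed time outermost. *)
Lemma ge0_integral_slot1 : (\int[mu \x tensor P mu]_x f (slot1 x) = \int[S]_x f x)%E.
Proof.
rewrite (fubini_tonelli2 (m1 := P) (m2 := tensor mu mu) f mf f0).
rewrite (fubini_tonelli1 (m1 := mu) (m2 := mu) _ mh h0).
rewrite (fubini_tonelli1 (m1 := mu) (m2 := tensor P mu) (f \o slot1)); last 2 first.
- exact: measurableT_comp.
- by move=> x; exact: f0.
apply: eq_integral => t _; rewrite /fubini_F.
rewrite (fubini_tonelli2 (m1 := P) (m2 := mu) (fun x => f (x.1, (t, x.2))))//.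
apply: measurableT_comp => //.
by apply: measurable_fun_pair => //; exact: measurable_fun_pair.
Qed.

Lemma ge0_integral_slot2 : (\int[mu \x tensor P mu]_x f (slot2 x) = \int[S]_x f x)%E.
Proof.
rewrite (fubini_tonelli2 (m1 := P) (m2 := tensor mu mu) f mf f0).
rewrite (fubini_tonelli2 (m1 := mu) (m2 := mu) _ mh h0).
rewrite (fubini_tonelli1 (m1 := mu) (m2 := tensor P mu) (f \o slot2)); last 2 first.
- exact: measurableT_comp.
- by move=> x; exact: f0.
apply: eq_integral => t _; rewrite /fubini_F.
rewrite (fubini_tonelli2 (m1 := P) (m2 := mu) (fun x => f (x.1, (x.2, t))))//.
apply: measurableT_comp => //.
by apply: measurable_fun_pair => //; exact: measurable_fun_pair.
Qed.

End nonnegative.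

Variable G : Om * (RR * RR) -> R.
Hypothesis sG : summable_fun S G.
Let mG : measurable_fun setT (EFin \o G). Proof. exact: measurable_int sG. Qed.

Let slots (slot : RR * (Om * RR) -> Om * (RR * RR)) :
  measurable_fun setT slot ->
  (forall f, (forall x, (0 <= f x)%E) -> measurable_fun setT f ->
     \int[mu \x tensor P mu]_x f (slot x) = \int[S]_x f x)%E ->
  summable_fun (mu \x tensor P mu)%E (G \o slot) /\
  (\int[(mu \x tensor P mu)%E]_x G (slot x) = \int[S]_x G x)%R.
Proof.
move=> mslot E; split.
  apply/integrableP; split; first exact: (measurableT_comp mG mslot).
  have /integrableP[_] := sG; rewrite -(E (abse \o (EFin \o G)))//.
    by move=> x; exact: abse_ge0.
  exact: measurableT_comp.
congr fine; rewrite integralE [RHS]integralE; congr (_ - _)%E.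
- rewrite -[RHS](E _ (fun x => funepos_ge0 _ x) (measurable_funepos mG)).
  by apply: eq_integral => x _; rewrite !funeposE.
- rewrite -[RHS](E _ (fun x => funeneg_ge0 _ x) (measurable_funeneg mG)).
  by apply: eq_integral => x _; rewrite !funenegE.
Qed.

(** The forward equation fixes the first time of the pairing, the backward equation the second. This
    lemma and [fubini_slot2] give both iterated integrals the same value, that over [S]. *)
Lemma fubini_slot1 :
  [/\ {ae mu, forall t, summable_fun Q (fun x => G (x.1, (t, x.2)))},
      summable_fun mu (fun t => \int[Q]_x G (x.1, (t, x.2)))%R &
      (\int[mu]_t (\int[Q]_x G (x.1, (t, x.2))) = \int[S]_x G x)%R].
Proof.
have [s e] := slots measurable_slot1 ge0_integral_slot1.
have [s' e'] := fubini_Rintegral1 s.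
by split; [exact: fubini_summable1 s|exact: s'|rewrite -e; exact: e'].
Qed.

Lemma fubini_slot2 :
  [/\ {ae mu, forall s, summable_fun Q (fun x => G (x.1, (x.2, s)))},
      summable_fun mu (fun s => \int[Q]_x G (x.1, (x.2, s)))%R &
      (\int[mu]_s (\int[Q]_x G (x.1, (x.2, s))) = \int[S]_x G x)%R].
Proof.
have [s e] := slots measurable_slot2 ge0_integral_slot2.
have [s' e'] := fubini_Rintegral1 s.
by split; [exact: fubini_summable1 s|exact: s'|rewrite -e; exact: e'].
Qed.

End TimeSlices.

(** * Integrability of convolutions with a kernel in the time difference *)

Section Convolution.
Context d (Om : measurableType d) (R : realType) (P : probability Om R).
Local Notation mu := (@lebesgue_measure R).
Local Notation RR := (measurableTypeR R).
Local Notation Q := (P \x mu)%E.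
Local Notation S := (P \x tensor mu mu)%E.

(** The kernel bounds hold almost surely for almost every pair of times, with an exceptional event
    that depends on the pair; the comparison is therefore made with the sample point integrated
    first. *)
Lemma summable_ae_le (f g : Om * (RR * RR) -> R) : measurable_fun setT f ->
  summable_fun S g -> (forall x, 0 <= g x) ->
  {ae tensor mu mu, forall u, {ae P, forall w, `|f (w, u)| <= g (w, u)}} ->
  summable_fun S f.
Proof.
move=> mf sg g0 fg.
have mf' : measurable_fun setT (EFin \o f) by exact/measurable_EFinP.
have mg' := measurable_int _ sg.
apply/(integrable21ltyP _ _ mf').
apply: le_lt_trans ((integrable21ltyP _ _ mg').1 sg).
have A0 (h : Om * (RR * RR) -> R) x : (0 <= (abse \o (EFin \o h)) x)%E.
  exact: abse_ge0.
have mA h : measurable_fun setT (EFin \o h) ->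
    measurable_fun setT (abse \o (EFin \o h : Om * (RR * RR) -> \bar R)).
  by move=> mh; exact: measurableT_comp mh.
apply: ae_ge0_le_integral => //.
- by move=> u _; apply: integral_ge0.
- exact: (measurable_fun_fubini_tonelli_G _ (mA _ mf') (A0 _)).
- by move=> u _; apply: integral_ge0.
- exact: (measurable_fun_fubini_tonelli_G _ (mA _ mg') (A0 _)).
apply: filterS fg => u fgu _; apply: ae_ge0_le_integral => //.
- by apply: (measurableT_comp (mA _ mf')).
- by apply: (measurableT_comp (mA _ mg')).
by apply: filterS fgu => w fgw _; rewrite /= lee_fin (ger0_norm (g0 _)).
Qed.

Variable k : R -> R.
Hypotheses (k0 : forall r, 0 <= k r) (sk : summable_fun mu k).
Variable a : Om * RR -> R.
Hypotheses (a0 : forall x, 0 <= a x) (sa : summable_fun Q a).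

Let mk : measurable_fun setT k := summable_measurable sk.
Let ma : measurable_fun setT a := summable_measurable sa.

Let mker : measurable_fun setT (fun x : Om * (RR * RR) => k (x.2.1 - x.2.2)).
Proof.
apply: measurableT_comp mk _; apply: measurable_funB.
  exact: measurableT_comp measurable_fst measurable_snd.
exact: measurableT_comp measurable_snd measurable_snd.
Qed.

Let alpha (t : RR) : \bar R := (\int[P]_w (a (w, t))%:E)%E.

Let ma' : measurable_fun setT (EFin \o a).
Proof. exact/measurable_EFinP. Qed.

Let a0' (x : Om * RR) : (0 <= (EFin \o a) x)%E. Proof. by rewrite lee_fin. Qed.

Let malpha : measurable_fun setT alpha.
Proof. exact: (measurable_fun_fubini_tonelli_G _ ma' a0'). Qed.

Let alpha0 (t : RR) : (0 <= alpha t)%E.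
Proof. by apply: integral_ge0 => w _; rewrite lee_fin. Qed.

(** The kernel is deterministic, so integrating over the sample point first replaces [a] by its mean
    [alpha]. *)
Let ker_alpha (pick : RR * RR -> RR) : measurable_fun setT pick ->
  summable_fun S (fun x => k (x.2.1 - x.2.2) * a (x.1, pick x.2)) <->
  (\int[mu \x mu]_u ((k (u.1 - u.2))%:E * alpha (pick u)) < +oo)%E.
Proof.
move=> mpick.
have mf : measurable_fun setT
    (fun x : Om * (RR * RR) => k (x.2.1 - x.2.2) * a (x.1, pick x.2)).
  apply: measurable_funM => //; apply: measurableT_comp => //.
  by apply: measurable_fun_pair => //; exact: measurableT_comp.
have mf' : measurable_fun setT (EFin \o
    (fun x : Om * (RR * RR) => k (x.2.1 - x.2.2) * a (x.1, pick x.2))).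
  exact/measurable_EFinP.
have E : (fun u : RR * RR => \int[P]_w
      `|(k (u.1 - u.2) * a (w, pick u))%:E|)%E =
    (fun u => (k (u.1 - u.2))%:E * alpha (pick u))%E.
  apply/funext => u; rewrite /alpha -ge0_integralZl//; last 3 first.
  - by apply: (measurableT_comp ma').
  - by move=> w _; rewrite lee_fin.
  - by rewrite lee_fin.
  by apply: eq_integral => w _; rewrite gee0_abs ?lee_fin ?mulr_ge0// EFinM.
have h := @integrable21ltyP _ _ _ _ _ P (tensor mu mu) _ mf'.
by move: h; rewrite /= [X in (\int[_]_y X y < _)%E]E.
Qed.

Let mass_ker : (\int[mu]_x (k x)%:E < +oo)%E. Proof. exact: integrable_lty sk. Qed.

Let mk' : measurable_fun setT (fun x : R => (k x)%:E).
Proof. exact/measurable_EFinP. Qed.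

Let k0' (x : R) : (0 <= (k x)%:E)%E. Proof. by rewrite lee_fin. Qed.

Let mass_alpha : (\int[mu]_t alpha t < +oo)%E.
Proof.
rewrite /alpha -(fubini_tonelli2 (m1 := P) (m2 := mu) _ ma' a0').
exact: integrable_lty sa.
Qed.

Let mass : (\int[mu]_t ((\int[mu]_x (k x)%:E) * alpha t) < +oo)%E.
Proof.
rewrite ge0_integralZl//; last by apply: integral_ge0.
by rewrite lte_mul_pinfty// ?ge0_fin_numE// integral_ge0.
Qed.

Let mker2 : measurable_fun setT (fun u : RR * RR => (k (u.1 - u.2))%:E).
Proof.
apply: (measurableT_comp mk'); apply: measurable_funB => //.
Qed.

(** Integrating first over the time absent from [a] leaves the total mass of [k] times the integral
    of [alpha]. Here that time is s, and s |-> k(t - s) calls for the reflection; in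
    [summable_conv2] it is t, and a translation suffices. *)
Lemma summable_conv1 :
  summable_fun S (fun x => k (x.2.1 - x.2.2) * a (x.1, x.2.1)).
Proof.
apply/(ker_alpha (@measurable_fst _ _ RR RR)).
rewrite (fubini_tonelli1 (m1 := mu) (m2 := mu)); last 2 first.
- by apply: emeasurable_funM => //; exact: measurableT_comp malpha _.
- by move=> u; rewrite mule_ge0.
apply: le_lt_trans mass; rewrite le_eqVlt; apply/orP; left; apply/eqP.
apply: eq_integral => t _; rewrite /fubini_F/= ge0_integralZr//.
- by rewrite (ge0_integral_reflect t k0' mk').
- by apply: (measurableT_comp mk'); exact: measurable_funB.
Qed.

Lemma summable_conv2 :
  summable_fun S (fun x => k (x.2.1 - x.2.2) * a (x.1, x.2.2)).
Proof.
apply/(ker_alpha (@measurable_snd _ _ RR RR)).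
rewrite (fubini_tonelli2 (m1 := mu) (m2 := mu)); last 2 first.
- by apply: emeasurable_funM => //; exact: measurableT_comp malpha _.
- by move=> u; rewrite mule_ge0.
apply: le_lt_trans mass; rewrite le_eqVlt; apply/orP; left; apply/eqP.
apply: eq_integral => s _; rewrite /fubini_G/= ge0_integralZr//.
- by rewrite (ge0_integral_translate s k0' mk').
- by apply: (measurableT_comp mk'); exact: measurable_funB.
Qed.

End Convolution.

(** * Absolute convergence of the pairings *)

Section WeightedProducts.
Context d (Om : measurableType d) (R : realType) (P : probability Om R).
Local Notation mu := (@lebesgue_measure R).
Local Notation RR := (measurableTypeR R).
Local Notation Q := (P \x mu)%E.
Local Notation S := (P \x tensor mu mu)%E.
Variables (rate eta lambda : R).
Hypothesis rate_le : rate <= eta + lambda.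

Let weight (t s Y X : R) : 0 <= t ->
  expR (- lambda * t) * (`|Y| * `|X|) <=
  expR (- rate * (t - s)) * ((expR (eta * t) * `|Y|) * (expR (- rate * s) * `|X|)).
Proof.
move=> t0; rewrite (mulrACA (expR (eta * t))) [X in _ <= X]mulrA.
rewrite ler_wpM2r ?mulr_ge0// -!expRD ler_expR.
have : 0 <= (eta + lambda - rate) * t by rewrite mulr_ge0// subr_ge0.
by lra.
Qed.

Variables (c : Om * (RR * RR) -> R) (K : R -> R).
Hypotheses (mc : measurable_fun setT c) (K0 : forall r, 0 <= K r).
Hypothesis cK : {ae tensor mu mu, forall u,
  {ae P, forall w, `|c (w, u)| <= K (u.1 - u.2)}}.

Variable x : Om * RR -> R.
Hypotheses (mx : measurable_fun setT x)
  (sx : sqint Q (fun z => expR (- rate * z.2) * x z)).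

Let mx2 : measurable_fun setT (fun z : Om * (RR * RR) => x (z.1, z.2.2)).
Proof.
apply: (measurableT_comp mx).
by apply: measurable_fun_pair => //; exact: measurableT_comp.
Qed.

Let mexp : measurable_fun setT (fun z : Om * (RR * RR) => expR (- lambda * z.2.1)).
Proof.
apply: measurableT_comp => //; apply: measurable_funM => //.
exact: measurableT_comp.
Qed.

Lemma summable_drift (y : Om * RR -> R) : measurable_fun setT y ->
  (forall w t, t < 0 -> y (w, t) = 0) ->
  sqint Q (fun z => expR (eta * z.2) * y z) ->
  summable_fun mu (fun r => expR (- rate * r) * K r) ->
  summable_fun S (fun z => expR (- lambda * z.2.1) *
    (c z * (y (z.1, z.2.1) * x (z.1, z.2.2)))).
Proof.
move=> my y0 sy sK.
pose k r := expR (- rate * r) * K r.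
have k0 r : 0 <= k r by rewrite mulr_ge0// expR_ge0.
pose a (z : Om * RR) := (expR (eta * z.2) * y z) ^+ 2.
pose b (z : Om * RR) := (expR (- rate * z.2) * x z) ^+ 2.
have a0 z : 0 <= a z by exact: sqr_ge0.
have b0 z : 0 <= b z by exact: sqr_ge0.
(* AM-GM splits the product of [y] and [x] into two convolutions with [k]. *)
apply: (summable_ae_le (g := fun z => k (z.2.1 - z.2.2) * a (z.1, z.2.1) +
    k (z.2.1 - z.2.2) * b (z.1, z.2.2))).
- apply: measurable_funM => //; apply: measurable_funM => //.
  apply: measurable_funM => //; apply: (measurableT_comp my).
  by apply: measurable_fun_pair => //; exact: measurableT_comp.
- apply: summableD.
    exact: (summable_conv1 k0 sK a0 sy.2).
  exact: (summable_conv2 k0 sK b0 sx.2).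
- by move=> z; rewrite addr_ge0// mulr_ge0.
apply: filterS cK => u; apply: filterS => w cw.
rewrite -mulrDr /k; case: u cw => t s /= cw.
set e1 := expR (- rate * (t - s)); have e1_ge0 : 0 <= e1 by exact: expR_ge0.
(* For negative [t] the exponents in [weight] may compare the wrong way, but there [y] vanishes. *)
have [t0|t0] := ltP t 0.
  by rewrite y0// mul0r !mulr0 normr0 !mulr_ge0// addr_ge0.
set A := expR (eta * t) * `|y (w, t)|.
set B := expR (- rate * s) * `|x (w, s)|.
have AE : a (w, t) = A ^+ 2 by rewrite /a /A !exprMn real_normK ?num_real.
have BE : b (w, s) = B ^+ 2 by rewrite /b /B !exprMn real_normK ?num_real.
rewrite !normrM (ger0_norm (expR_ge0 _)) mulrCA AE BE.
apply: (@le_trans _ _ (K (t - s) * (e1 * (A * B)))).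
  by apply: ler_pM => //; exact: weight.
rewrite mulrA (mulrC _ e1) ler_wpM2l ?mulr_ge0//.
by nra.
Qed.

(** Here [y] depends on both times and its weighted square is integrable over [S] as it stands.
    AM-GM therefore keeps the kernel with [x], which leaves a single convolution, of the squared
    weighted kernel with the squared weighted [x]. *)
Lemma summable_diffusion (y : Om * (RR * RR) -> R) : measurable_fun setT y ->
  (forall w t s, t < 0 -> y (w, (t, s)) = 0) ->
  summable_fun S (fun z => (expR (eta * z.2.1) * y z) ^+ 2) ->
  summable_fun mu (fun r => (expR (- rate * r) * K r) ^+ 2) ->
  summable_fun S (fun z => expR (- lambda * z.2.1) *
    (c z * (y z * x (z.1, z.2.2)))).
Proof.
move=> my y0 sy sK.
pose k r := (expR (- rate * r) * K r) ^+ 2.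
have k0 r : 0 <= k r by exact: sqr_ge0.
pose a (z : Om * (RR * RR)) := (expR (eta * z.2.1) * y z) ^+ 2.
pose b (z : Om * RR) := (expR (- rate * z.2) * x z) ^+ 2.
have a0 z : 0 <= a z by exact: sqr_ge0.
have b0 z : 0 <= b z by exact: sqr_ge0.
apply: (summable_ae_le (g := fun z => a z + k (z.2.1 - z.2.2) * b (z.1, z.2.2))).
- apply: measurable_funM => //; apply: measurable_funM => //.
  exact: measurable_funM.
- by apply: summableD => //; exact: (summable_conv2 k0 sK b0 sx.2).
- by move=> z; rewrite addr_ge0// mulr_ge0.
apply: filterS cK => u; apply: filterS => w cw.
rewrite /k; case: u cw => t s /= cw.
set e1 := expR (- rate * (t - s)); have e1_ge0 : 0 <= e1 by exact: expR_ge0.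
have [t0|t0] := ltP t 0.
  by rewrite y0// mul0r !mulr0 normr0 addr_ge0// mulr_ge0// sqr_ge0.
set A := expR (eta * t) * `|y (w, (t, s))|.
set B := expR (- rate * s) * `|x (w, s)|.
have AE : a (w, (t, s)) = A ^+ 2 by rewrite /a /A !exprMn real_normK ?num_real.
have BE : b (w, s) = B ^+ 2 by rewrite /b /B !exprMn real_normK ?num_real.
rewrite !normrM (ger0_norm (expR_ge0 _)) mulrCA AE BE.
apply: (@le_trans _ _ (K (t - s) * (e1 * (A * B)))).
  by apply: ler_pM => //; exact: weight.
have -> : K (t - s) * (e1 * (A * B)) = A * (e1 * K (t - s) * B) by ring.
have -> : (e1 * K (t - s)) ^+ 2 * B ^+ 2 = (e1 * K (t - s) * B) ^+ 2 by rewrite -exprMn.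
by nra.
Qed.

End WeightedProducts.

(** * Coordinates of the processes and kernels *)

Section FrobeniusNorm.
Context (R : realType).

Lemma frob_sqr m n (A : 'M[R]_(m, n)) : frob A ^+ 2 = \sum_i \sum_j A i j ^+ 2.
Proof.
rewrite sqr_sqrtr// sumr_ge0// => i _.
by rewrite sumr_ge0// => j _; exact: sqr_ge0.
Qed.

Lemma le_sqrt_sum (I : finType) (f : I -> R) i :
  `|f i| <= Num.sqrt (\sum_j f j ^+ 2).
Proof.
rewrite -sqrtr_sqr ler_wsqrtr// (bigD1 i)//= lerDl sumr_ge0// => j _.
exact: sqr_ge0.
Qed.

Lemma le_frob m n (A : 'M[R]_(m, n)) i j : `|A i j| <= frob A.
Proof.
rewrite -sqrtr_sqr ler_wsqrtr// (bigD1 i)//= (bigD1 j)//= -addrA lerDl.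
by rewrite addr_ge0// sumr_ge0// => k _; rewrite ?sumr_ge0// => *; exact: sqr_ge0.
Qed.

End FrobeniusNorm.

(** * From the weighted process spaces to real functions on product spaces *)

Section ProcessSpaces.
Context d (Om : measurableType d) (R : realType) (P : probability Om R).
Hypothesis P_complete : measure_is_complete P.
Variables (D : nat) (W : 'I_D -> R -> Om -> R).
Hypothesis W_bm : brownian_motion P W.
Local Notation mu := (@lebesgue_measure R).
Local Notation RR := (measurableTypeR R).
Local Notation Q := (P \x mu)%E.
Local Notation S := (P \x tensor mu mu)%E.
Local Notation halfline := (`[0, +oo[%classic : set R).
Variable n : nat.

Definition coordinate (f : R -> Om -> 'cV[R]_n) (i : 'I_n) : Om * RR -> R :=
  cut_off halfline (fun t w => f t w i 0).

Lemma coordinateE f i w t : 0 <= t -> coordinate f i (w, t) = f t w i 0.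
Proof.
by move=> t0; rewrite /coordinate /cut_off indicE mem_setE in_itv/= t0 mul1r.
Qed.

Lemma coordinate_lt0 f i w t : t < 0 -> coordinate f i (w, t) = 0.
Proof.
move=> t0; rewrite /coordinate /cut_off indicE mem_setE in_itv/=.
by rewrite leNgt t0 mul0r.
Qed.

Lemma filtration_infty_measurable A : filtration_infty P W A -> measurable A.
Proof.
apply; split; first exact: sigma_algebra_measurable.
by move=> B [t _ /(augmented_measurable P_complete W_bm)].
Qed.

(** The identity of [Om] is measurable from the full sigma-algebra to that of [filtration_infty],
    and composing with it transports joint measurability. *)
Lemma L2_Finfty_measurable beta f i : L2_Finfty P W beta f ->
  measurable_fun setT (coordinate f i).
Proof.
move=> [mf _]; apply: measurable_cut_off => // mD Y mY.
pose T := g_sigma_algebraType (filtration_infty P W).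
have midl : measurable_fun setT (fun w : Om => w : T).
  move=> _ A mA; rewrite setTI; apply: filtration_infty_measurable.
  have idE : <<s filtration_infty P W >> = filtration_infty P W.
    by apply: sigma_algebra_id; exact: smallest_sigma_algebra.
  by rewrite -idE; exact: mA.
have mh : measurable_fun setT (fun x : Om * R => (x.1 : T, x.2)).
  apply: measurable_fun_pair => //.
  exact: measurableT_comp midl measurable_fst.
have mDT : measurable (setT `*` halfline : set (T * R)) by exact: measurableX.
have := mh measurableT _ (mf i mDT Y mY); rewrite setTI.
by congr (measurable _); apply/seteqP; split => -[w s].
Qed.

(** Tonelli turns the iterated integral of [L2_Finfty] into one over the product, where [total], the
    weighted squared Frobenius norm extended by zero, dominates each squared coordinate. *)
Lemma L2_Finfty_sqint beta f i : L2_Finfty P W beta f ->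
  sqint Q (fun z => expR (beta * z.2) * coordinate f i z).
Proof.
move=> Lf; have mf j := L2_Finfty_measurable j Lf.
have mexp : measurable_fun setT (fun z : Om * RR => expR (beta * z.2)).
  apply: measurableT_comp => //; exact: measurable_funM.
have mg j : measurable_fun setT (fun z : Om * RR => expR (beta * z.2) * coordinate f j z).
  exact: (measurable_funM mexp (mf j)).
pose total (z : Om * RR) : R := \sum_j (expR (beta * z.2) * coordinate f j z) ^+ 2.
have total0 z : 0 <= total z by apply: sumr_ge0 => j _; exact: sqr_ge0.
have mtotal : measurable_fun setT total.
  by apply: measurable_sum => j; exact: (measurable_funX _ (mg j)).
pose g w s := total (w, s).
have mtot : measurable_fun setT (fun x : Om * RR => g x.1 x.2).
  by rewrite (_ : (fun x => _) = total)//; apply/funext => -[].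
have gneg w s : s < 0 -> g w s = 0.
  by move=> s0; rewrite /g /total big1// => j _; rewrite coordinate_lt0// mulr0 expr0n.
have E := integral_halfline P mtot (fun w s => total0 (w, s)) gneg.
have stotal : summable_fun Q total.
  apply/integrableP; split; first exact/measurable_EFinP.
  under eq_integral do rewrite gee0_abs ?lee_fin//.
  have := Lf.2; congr (_ < _)%E.
  transitivity (\int[Q]_x (g x.1 x.2)%:E)%E; last first.
    by apply: eq_integral => -[].
  rewrite -[RHS]E.
  apply: eq_integral => w _; apply: eq_integral => s.
  rewrite inE/= in_itv/= andbT => s0; congr EFin.
  rewrite frob_sqr mulr_sumr /g /total; apply: eq_bigr => j _.
  rewrite big_ord1 coordinateE// exprMn; congr (_ * _).
  by rewrite -mulrA mulr_natl mulr2n expRD expr2.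
split; first exact: mg.
apply: summable_le stotal; first exact: (measurable_funX _ (mg i)).
move=> z; rewrite ger0_norm ?sqr_ge0// /total (bigD1 i)//= lerDl sumr_ge0// => j _.
exact: sqr_ge0.
Qed.

Definition cut_off2 (A : set (R * R)) (F : R -> R -> Om -> R)
  (x : Om * (RR * RR)) : R := \1_A x.2 * F x.2.1 x.2.2 x.1.

Lemma measurable_cut_off2 A F : measurable A ->
  measurable_fun (setT `*` A) (fun x : Om * (R * R) => F x.2.1 x.2.2 x.1) ->
  measurable_fun setT (cut_off2 A F).
Proof.
move=> mA mf.
have mTA : measurable (setT `*` A : set (Om * (R * R))) by exact: measurableX.
have /(measurable_restrictT _ mTA) h := mf.
apply: eq_measurable_fun h => -[w u] _; rewrite /cut_off2 patchE indicE /=.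
have -> : ((w, u) \in setT `*` A) = (u \in A).
  by apply/idP/idP; rewrite !inE /=; [case|split].
by case: ifPn => _; rewrite ?mul1r ?mul0r.
Qed.

Lemma cut_off2E A F w t s : A (t, s) -> cut_off2 A F (w, (t, s)) = F t s w.
Proof. by move=> Ats; rewrite /cut_off2 indicE mem_set// mul1r. Qed.

Lemma cut_off2_out A F w t s : ~ A (t, s) -> cut_off2 A F (w, (t, s)) = 0.
Proof. by move=> Ats; rewrite /cut_off2 indicE memNset// mul0r. Qed.

Local Notation quadrant := (halfline `*` halfline).

Lemma quadrantE t s : quadrant (t, s) <-> (0 <= t) && (0 <= s).
Proof.
split=> [[]/=|/andP[t0 s0]]; first by rewrite !in_itv/= !andbT => -> ->.
by split; rewrite /= in_itv/= andbT.
Qed.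

Lemma L2_F2_measurable beta Z i k : L2_F2 (n := n) P W beta Z ->
  measurable_fun setT (cut_off2 quadrant (fun t s w => Z t s w i k)).
Proof. by move=> [mZ _ _]; apply: measurable_cut_off2 => //; exact: measurableX. Qed.

Lemma L2_F2_summable beta Z i k : L2_F2 (n := n) P W beta Z ->
  summable_fun S (fun x => (expR (beta * x.2.1) *
    cut_off2 quadrant (fun t s w => Z t s w i k) x) ^+ 2).
Proof.
move=> LZ; have mf j l := L2_F2_measurable j l LZ.
set z := fun j l => cut_off2 quadrant (fun t s w => Z t s w j l).
have mexp : measurable_fun setT (fun x : Om * (RR * RR) => expR (beta * x.2.1)).
  apply: measurableT_comp => //; apply: measurable_funM => //.
  exact: measurableT_comp.
pose term j l (x : Om * (RR * RR)) : R := (expR (beta * x.2.1) * z j l x) ^+ 2.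
have mterm j l : measurable_fun setT (term j l).
  exact: (measurable_funX _ (measurable_funM mexp (mf j l))).
pose total (x : Om * (RR * RR)) : R := \sum_j \sum_l term j l x.
have total0 x : 0 <= total x.
  by apply: sumr_ge0 => j _; apply: sumr_ge0 => l _; exact: sqr_ge0.
have mtotal : measurable_fun setT total.
  by apply: measurable_sum => j; apply: measurable_sum => l; exact: mterm.
have mtotal' : measurable_fun setT (EFin \o total) by exact/measurable_EFinP.
have total0' x : (0 <= (EFin \o total) x)%E by rewrite lee_fin.
have stotal : summable_fun S total.
  apply/integrableP; split => //.
  under eq_integral do rewrite gee0_abs ?lee_fin//.
  have [_ _] := LZ; congr (_ < _)%E.
  rewrite (fubini_tonelli1 (m1 := P) (m2 := tensor mu mu) _ mtotal' total0').
  apply: eq_integral => w _; rewrite /fubini_F.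
  have msec : measurable_fun setT (fun u : RR * RR => (total (w, u))%:E).
    by apply: (measurableT_comp mtotal').
  rewrite [RHS](fubini_tonelli1 (m1 := mu) (m2 := mu) _ msec (fun u => total0' (w, u))).
  rewrite [LHS]integral_mkcond; apply: eq_integral => t _.
  rewrite /fubini_F patchE mem_setE in_itv/= andbT; case: ifPn => t0; last first.
    rewrite integral0_eq// => s _; rewrite /total big1// => j _; rewrite big1// => l _.
    rewrite /term /z cut_off2_out ?mulr0 ?expr0n//.
    by move=> /quadrantE; rewrite (negbTE t0).
  pose h s : R := \sum_j \sum_l z j l (w, (t, s)) ^+ 2.
  have mh : measurable_fun setT (fun s : RR => (h s)%:E).
    apply/measurable_EFinP; apply: measurable_sum => j; apply: measurable_sum => l.
    apply: measurable_funX; apply: (measurableT_comp (mf j l)).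
    by apply: measurable_fun_pair => //; exact: measurable_fun_pair.
  have -> : (\int[mu]_(s in halfline) (frob (Z t s w) ^+ 2)%:E =
             \int[mu]_s (h s)%:E)%E.
    rewrite integral_mkcond; apply: eq_integral => s _.
    rewrite patchE mem_setE in_itv/= andbT /h; case: ifPn => s0; last first.
      rewrite big1// => j _; rewrite big1// => l _; rewrite /z cut_off2_out ?expr0n//.
      by move=> /quadrantE; rewrite (negbTE s0) andbF.
    rewrite frob_sqr; congr EFin; apply: eq_bigr => j _; apply: eq_bigr => l _.
    by rewrite /z cut_off2E//; apply/quadrantE; rewrite t0.
  rewrite -ge0_integralZl//; last first.
    move=> s _; rewrite lee_fin sumr_ge0// => j _.
    by rewrite sumr_ge0// => l _; exact: sqr_ge0.
  apply: eq_integral => s _; rewrite -EFinM /h mulr_sumr /total; congr EFin.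
  apply: eq_bigr => j _; rewrite mulr_sumr; apply: eq_bigr => l _.
  rewrite /term [RHS]exprMn; congr (_ * _).
  by rewrite -mulrA mulr_natl mulr2n expRD expr2.
apply: summable_le stotal; first exact: mterm.
move=> x; rewrite ger0_norm ?sqr_ge0// /total (bigD1 i)//= (bigD1 k)//= -addrA lerDl.
by rewrite addr_ge0// sumr_ge0// => j _; rewrite ?sumr_ge0// => *; exact: sqr_ge0.
Qed.

Definition kernel_on_halfline (f : R -> R) (r : R) : R := \1_halfline r * f r.

Lemma kernel_on_halflineE f r : 0 <= r -> kernel_on_halfline f r = f r.
Proof.
by move=> r0; rewrite /kernel_on_halfline indicE mem_setE in_itv/= r0 mul1r.
Qed.

Lemma kernel_on_halfline_lt0 f r : r < 0 -> kernel_on_halfline f r = 0.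
Proof.
rewrite ltNge => /negbTE r0.
by rewrite /kernel_on_halfline indicE mem_setE in_itv/= r0 mul0r.
Qed.

Lemma kernel_on_halfline_ge0 f : (forall r, 0 <= r -> 0 <= f r) ->
  forall r, 0 <= kernel_on_halfline f r.
Proof.
move=> f0 r; have [r0|r0] := leP 0 r; last by rewrite kernel_on_halfline_lt0.
by rewrite kernel_on_halflineE// f0.
Qed.

(** A bracket at most 1 is finite, hence so is the integral under the root, and at nonnegative times
    a larger rate shrinks the exponential weight. The index [p.+1] keeps the exponent of the root
    nonzero. *)
Lemma bracket_summable p f (rho rate : R) : Lstar p.+1 f -> rho <= rate ->
  (bracket p.+1 f rho <= 1)%E ->
  summable_fun mu (fun r => (expR (- rate * r) * kernel_on_halfline f r) ^+ p.+1).
Proof.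
move=> [mf f0 _] rr; rewrite /bracket => h.
have F0 (t : R) : 0 <= t -> 0 <= expR (- (p.+1%:R * rho * t)) * f t ^+ p.+1.
  by move=> t0; rewrite mulr_ge0 ?expR_ge0// exprn_ge0// f0.
have mhl : measurable halfline by exact: measurable_itv.
have Ifin : (\int[mu]_(t in halfline)
    (expR (- (p.+1%:R * rho * t)) * f t ^+ p.+1)%:E < +oo)%E.
  apply: (@lty_poweRy _ _ p.+1%:R^-1); first by rewrite invr_neq0// pnatr_eq0.
  exact: le_lt_trans h (ltry _).
have mk : measurable_fun setT (kernel_on_halfline f).
  have /(measurable_restrictT _ mhl) h' := mf.
  apply: eq_measurable_fun h' => r _; rewrite patchE /kernel_on_halfline indicE.
  by case: ifPn => _; rewrite ?mul1r ?mul0r.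
have mterm : measurable_fun setT
    (fun r : R => (expR (- rate * r) * kernel_on_halfline f r) ^+ p.+1).
  apply: measurable_funX; apply: measurable_funM => //.
  by apply: measurableT_comp => //; exact: measurable_funM.
have mexp : measurable_fun setT (fun t : R => expR (- (p.+1%:R * rho * t))).
  by apply: measurableT_comp => //; apply: measurableT_comp => //; exact: measurable_funM.
apply: (@summable_le _ _ _ _ _
  (fun r : RR => expR (- (p.+1%:R * rho * r)) * kernel_on_halfline f r ^+ p.+1)) => //.
- move=> r; have [r0|r0] := leP 0 r; last first.
    by rewrite kernel_on_halfline_lt0// mulr0 !expr0n normr0 mulr0.
  rewrite kernel_on_halflineE// ger0_norm; last first.
    by rewrite exprn_ge0// mulr_ge0 ?expR_ge0// f0.
  rewrite exprMn ler_wpM2r ?exprn_ge0 ?f0//.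
  rewrite -expRM_natl ler_expR.
  have : 0 <= p.+1%:R * ((rate - rho) * r) by rewrite !mulr_ge0// subr_ge0.
  by lra.
- apply/integrableP; split.
    by apply/measurable_EFinP; apply: measurable_funM => //; exact: measurable_funX.
  move: Ifin; rewrite [X in (X < _)%E -> _]integral_mkcond; congr (_ < _)%E.
  apply: eq_integral => r _; rewrite patchE mem_setE in_itv/= andbT.
  case: ifPn => [r0|r0]; last first.
    by rewrite kernel_on_halfline_lt0 ?ltNge// expr0n mulr0 normr0.
  by rewrite /= kernel_on_halflineE// ger0_norm// F0.
Qed.

(** An infimum strictly below [rate] yields some rho < rate at which the brackets sum to at most 1;
    as both are nonnegative, each is at most 1. This includes the case where the infimum is -oo. *)
Lemma rho_CD_lt_summable KC KD rate : Lstar 1 KC -> Lstar 2 KD ->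
  (rho_CD KC KD < rate%:E)%E ->
  summable_fun mu (fun r => expR (- rate * r) * kernel_on_halfline KC r) /\
  summable_fun mu (fun r => (expR (- rate * r) * kernel_on_halfline KD r) ^+ 2).
Proof.
move=> LC LD /ereal_inf_lt[_ [rho /= h <-]]; rewrite lte_fin => /ltW rr.
split.
  apply: (@bracket_summable 0 KC rho) => //.
  by apply: le_trans h; rewrite leeDl// poweR_ge0.
apply: (@bracket_summable 1 KD rho) => //.
by apply: le_trans h; rewrite leeDr// poweR_ge0.
Qed.

Lemma measurable_triangle : measurable (@triangle R).
Proof.
have -> : @triangle R = snd @^-1` halfline `&` (fun u => u.1 - u.2) @^-1` halfline.
  apply/seteqP; split => u; rewrite /triangle /= !in_itv/= !andbT subr_ge0.
    by move=> /andP[].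
  by move=> [-> ->].
apply: measurableI; rewrite -[X in measurable X]setTI.
  exact: measurable_snd.
by apply: measurable_funB.
Qed.

End ProcessSpaces.

(** * Processes at a fixed time, and the discounted inner product *)

Section Slices.
Context d (Om : measurableType d) (R : realType) (P : probability Om R).
Local Notation mu := (@lebesgue_measure R).
Local Notation RR := (measurableTypeR R).
Local Notation Q := (P \x mu)%E.
Local Notation halfline := (`[0, +oo[%classic : set R).

Lemma sqint_slice (beta : R) (f : Om * RR -> R) : measurable_fun setT f ->
  sqint Q (fun z => expR (beta * z.2) * f z) ->
  {ae mu, forall t, sqint P (fun w => f (w, t))}.
Proof.
move=> mf [_ sf]; apply: filterS (fubini_summable2 sf) => t st; split.
  apply: (measurableT_comp mf); exact: measurable_fun_pair.
apply: eq_summable (summableZ (expR (beta * t) ^- 2) st) => w /=.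
by rewrite exprMn mulKf// expf_neq0// gt_eqF// expR_gt0.
Qed.

Lemma scaled_vint n (A : set R) (f : R -> 'cV[R]_n) i (c : R) (h : RR -> R) :
  (forall s, A s -> c * f s i 0 = h s) -> (forall s, ~ A s -> h s = 0) ->
  summable_fun mu h -> c * vint A f i 0 = (\int[mu]_s h s)%R.
Proof.
move=> hA hN sh; rewrite mxE Rintegral_mkcond.
have E s : c * ((fun s => f s i 0) \_ A) s = h s.
  rewrite patchE; have [As|nAs] := pselect (A s).
    by rewrite mem_set//; exact: hA.
  by rewrite memNset// hN// mulr0.
rewrite -RintegralZ_summable; last exact: eq_summable sh.
by apply: eq_Rintegral => s _; exact: E.
Qed.

Lemma ae_imply dT (T : measurableType dT) (m : {measure set T -> \bar R})
    (A B : T -> Prop) : (forall t, A t -> B t) ->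
  {ae m, forall t, A t} -> {ae m, forall t, B t}.
Proof. by move=> AB; exact: filterS. Qed.

Lemma aeI dT (T : measurableType dT) (m : {measure set T -> \bar R})
    (A B : T -> Prop) : {ae m, forall t, A t} -> {ae m, forall t, B t} ->
  {ae m, forall t, A t /\ B t}.
Proof. by move=> hA hB; exact: filterS2 hA hB. Qed.

Lemma ae_forall_fin dT (T : measurableType dT) (m : {measure set T -> \bar R})
    (I : finType) (B : I -> T -> Prop) :
  (forall i, {ae m, forall t, B i t}) -> {ae m, forall t, forall i, B i t}.
Proof. by move=> aeB; apply: filter_forall. Qed.

Variable n : nat.
Implicit Types f g : R -> Om -> 'cV[R]_n.

Definition discounted_inner (lambda : R) f g (z : Om * RR) : R :=
  expR (- lambda * z.2) * \sum_i (coordinate f i z * coordinate g i z).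

Lemma discounted_inner_summable lambda eta rate f g : rate <= eta + lambda ->
  (forall i, measurable_fun setT (coordinate f i)) ->
  (forall i, measurable_fun setT (coordinate g i)) ->
  (forall i, sqint Q (fun z => expR (eta * z.2) * coordinate f i z)) ->
  (forall i, sqint Q (fun z => expR (- rate * z.2) * coordinate g i z)) ->
  summable_fun Q (discounted_inner lambda f g).
Proof.
move=> rate_le mf mg sf sg.
have mexp : measurable_fun setT (fun z : Om * RR => expR (- lambda * z.2)).
  by apply: measurableT_comp => //; exact: measurable_funM.
suff h i : summable_fun Q
    (fun z => expR (- lambda * z.2) * (coordinate f i z * coordinate g i z)).
  have := @summable_sum _ _ _ Q _ (index_enum 'I_n) xpredT _ (fun i _ => h i).
  by apply: eq_summable => z; rewrite /discounted_inner mulr_sumr.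
apply: summable_le (summableD (sf i).2 (sg i).2).
  exact: (measurable_funM mexp (measurable_funM (mf i) (mg i))).
move=> [w t]; have [t0|t0] := ltP t 0.
  by rewrite coordinate_lt0// mul0r mulr0 normr0 addr_ge0// sqr_ge0.
move: (coordinate f i (w, t)) (coordinate g i (w, t)) => y x /=.
rewrite !normrM (ger0_norm (expR_ge0 _)).
set A := expR (eta * t) * `|y|; set B := expR (- rate * t) * `|x|.
have -> : (expR (eta * t) * y) ^+ 2 = A ^+ 2.
  by rewrite /A !exprMn real_normK ?num_real.
have -> : (expR (- rate * t) * x) ^+ 2 = B ^+ 2.
  by rewrite /B !exprMn real_normK ?num_real.
apply: (@le_trans _ _ (A * B)); last by nra.
rewrite /A /B mulrACA ler_wpM2r ?mulr_ge0// -expRD ler_expR.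
have : 0 <= (eta + lambda - rate) * t by rewrite mulr_ge0// subr_ge0.
by lra.
Qed.

(** Time is moved outermost because the equations hold for almost every time, almost surely, with an
    exceptional event that depends on the time. *)
Lemma expectation_discounted_inner lambda f g :
  summable_fun Q (discounted_inner lambda f g) ->
  summable_fun mu (fun t => \int[P]_w discounted_inner lambda f g (w, t))%R /\
  ('E_P[fun w => (\int[mu]_(t in halfline)
      (expR (- lambda * t) * inner (f t w) (g t w)))%R] =
   (\int[mu]_t (\int[P]_w discounted_inner lambda f g (w, t)))%R%:E)%E.
Proof.
move=> sF; have [s2 e2] := fubini_Rintegral2 sF; split; first exact: s2.
have [s1 e1] := fubini_Rintegral1 sF.
rewrite e2 -e1 unlock /Rintegral fineK; last exact: (integrable_fin_num measurableT s1).
apply: eq_integral => w _; congr EFin; rewrite [LHS]Rintegral_mkcond.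
apply: eq_Rintegral => t _; rewrite patchE mem_setE in_itv/= andbT.
rewrite /discounted_inner /=; case: ifPn => t0; last first.
  by rewrite big1 ?mulr0// => i _; rewrite coordinate_lt0 ?mul0r// ltNge.
by congr (_ * _); apply: eq_bigr => i _; rewrite !coordinateE.
Qed.

Lemma discounted_inner_lt0 lambda f g (w : Om) (t : R) : t < 0 ->
  discounted_inner lambda f g (w, t) = 0.
Proof.
move=> t0; rewrite /discounted_inner big1 ?mulr0// => i _.
by rewrite coordinate_lt0 ?mul0r.
Qed.

Lemma discounted_inner_slice lambda (f g : R -> Om -> 'cV[R]_n) (t : R) : 0 <= t ->
  (forall i, sqint P (fun w => f t w i 0)) ->
  (forall i, sqint P (fun w => g t w i 0)) ->
  (\int[P]_w discounted_inner lambda f g (w, t) =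
   \sum_i \int[P]_w (expR (- lambda * t) * (f t w i 0 * g t w i 0)))%R.
Proof.
move=> t0 sf sg; rewrite -Rintegral_sum; last first.
  by move=> i _; apply/summableZ; exact: sqint_mul.
apply: eq_Rintegral => w _; rewrite /discounted_inner mulr_sumr.
by apply: eq_bigr => i _; rewrite !coordinateE.
Qed.

End Slices.

(** * Duality *)

Section Pairings.
Context d (Om : measurableType d) (R : realType) (P : probability Om R).
Hypothesis P_complete : measure_is_complete P.
Variables (n D0 : nat) (W : 'I_D0 -> R -> Om -> R).
Hypothesis W_bm : brownian_motion P W.
Local Notation mu := (@lebesgue_measure R).
Local Notation RR := (measurableTypeR R).
Local Notation Q := (P \x mu)%E.
Local Notation S := (P \x tensor mu mu)%E.
Local Notation halfline := (`[0, +oo[%classic : set R).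
Local Notation quadrant := (halfline `*` halfline).
Variables (C : R -> R -> Om -> 'M[R]_n) (D : 'I_D0 -> R -> R -> Om -> 'M[R]_n).
Variable lambda : R.
Variables (X Y : R -> Om -> 'cV[R]_n) (Z : R -> R -> Om -> 'M[R]_(n, D0)).

Let cC i j := cut_off2 (@triangle R) (fun t s (w : Om) => C t s w i j).
Let cD k i j := cut_off2 (@triangle R) (fun t s (w : Om) => D k t s w i j).
Let cZ i k := cut_off2 quadrant (fun t s (w : Om) => Z t s w i k).

(** In both pairings the first time is the later one: it carries the discount and the argument of
    [Y] or [Z], while [X] is taken at the earlier time. The cut-off of the kernel to the triangle
    restricts both the forward and the backward time integral. *)
Definition drift_pairing i j (z : Om * (RR * RR)) : R :=
  expR (- lambda * z.2.1) *
    (cC i j z * (coordinate Y i (z.1, z.2.1) * coordinate X j (z.1, z.2.2))).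

Definition diffusion_pairing k i j (z : Om * (RR * RR)) : R :=
  expR (- lambda * z.2.1) * (cD k i j z * (cZ i k z * coordinate X j (z.1, z.2.2))).

Definition pairing i j (z : Om * (RR * RR)) : R :=
  drift_pairing i j z + \sum_k diffusion_pairing k i j z.

Lemma triangleE (t s : R) : triangle (t, s) <-> 0 <= s <= t.
Proof. by []. Qed.

Lemma pairing_out i j w t s : ~ triangle (t, s) -> pairing i j (w, (t, s)) = 0.
Proof.
move=> h; rewrite /pairing /drift_pairing /diffusion_pairing /cC cut_off2_out//.
rewrite mul0r mulr0 add0r big1// => k _.
by rewrite /cD cut_off2_out// mul0r mulr0.
Qed.

(** Orthogonality to the past at time 0, tested against the constant 1. *)
Lemma ito_mean k A f I : measurable A -> A `<=` halfline ->
  is_ito1 P W k A f I -> (\int[P]_w I w = 0)%R.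
Proof.
move=> mA A0 itoI.
have F1 : F_measurable P W 0 (fun=> 1) by exact: measurable_cst.
have := ito_orthogonal_past P_complete W_bm (lexx 0) mA A0 itoI F1 (sqint_cst P 1).
by rewrite /ip; under eq_Rintegral do rewrite mul1r.
Qed.

Let itv_0t_sub (t : R) : `[0, t]%classic `<=` halfline.
Proof. by move=> s /=; rewrite !in_itv/= => /andP[->]. Qed.

(** * The forward equation at a fixed time *)

Section forward.
Variables (phi : R -> Om -> 'cV[R]_n) (t : R) (i : 'I_n).
Hypothesis t0 : 0 <= t.
Variables I I' : Om -> 'cV[R]_n.
Hypotheses (itoI : is_ito P W `[0, t]%classic
    (fun s w => \matrix_(i, k) (D k t s w *m X s w) i 0) I)
  (XE : {ae P, forall w, X t w = phi t w
          + vint `[0, t]%classic (fun s => C t s w *m X s w) + I w})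
  (itoI' : is_ito P W `[0, t]%classic (Z t) I')
  (YE : {ae P, forall w, Y t w = vexpect P (Y t) + I' w}).
Hypotheses (sX : sqint P (fun w => X t w i 0)) (sY : sqint P (fun w => Y t w i 0))
  (sphi : sqint P (fun w => phi t w i 0)).
Hypotheses (sdrift : forall j, summable_fun Q (fun z => drift_pairing i j (z.1, (t, z.2))))
  (sdiff : forall k j, summable_fun Q (fun z => diffusion_pairing k i j (z.1, (t, z.2)))).

Let y w := Y t w i 0.

(** In the martingale representation of [Y t] the mean contributes nothing because [J] has mean
    zero, and among the components of the stochastic integral only the one driven by [W k]
    correlates with [J]. *)
Lemma forward_martingale J k :
  is_ito1 P W k `[0, t]%classic (fun s w => (D k t s w *m X s w) i 0) J ->
  expR (- lambda * t) * ip P y J =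
  \sum_j (\int[Q]_z diffusion_pairing k i j (z.1, (t, z.2)))%R.
Proof.
move=> itoJ; have [J' [itoJ' I'E]] := itoI'.
have mA : measurable (`[0, t]%classic : set R) by [].
have iso l := ito_isometry P_complete W_bm mA (@itv_0t_sub t) mA (@itv_0t_sub t)
  (itoJ' i l) itoJ.
have sJ : sqint P J by have [_ sJ] := iso k.
have sJ' l : sqint P (J' i l) by have [] := iso l.
have yE : ip P y J = ip P (fun w => vexpect P (Y t) i 0 + \sum_l J' i l w) J.
  apply: ae_eq_Rintegral.
  - by apply: measurable_funM; [exact: sY.1|exact: sJ.1].
  - apply: measurable_funM; last exact: sJ.1.
    apply: measurable_funD => //; apply: measurable_sum => l; exact: (sJ' l).1.
  - by apply: filterS YE => w; rewrite /y => ->; rewrite I'E !mxE.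
rewrite yE ipDl//; last 2 first.
- exact: sqint_cst.
- by apply: sqint_sum => l _; exact: sJ'.
rewrite [X in X + _](_ : _ = 0) ?add0r; last first.
  rewrite /ip RintegralZl//; last exact: sqint_summable sJ.
  by rewrite (ito_mean mA (@itv_0t_sub t) itoJ) mulr0.
rewrite ip_suml; [|by move=> l _; exact: sJ'|by []].
rewrite (bigD1 k)//= big1 ?addr0; last first.
  by move=> l lk; have [_ _ _ _ ->] := iso l; rewrite (negbTE lk) mul0r.
have [_ _ sZ sDX ->] := iso k; rewrite eqxx mul1r.
(* The isometry gives square-integrability of the whole row of [D X]; that the sum over [j] may be
   integrated term by term is due to [sdiff]. *)
rewrite -Rintegral_sum; last by move=> j _; exact: sdiff.
rewrite /ip -RintegralZl//; last exact: sqint_mul.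
apply: eq_Rintegral => -[w s] _ /=.
rewrite /cut_off /= /diffusion_pairing /= -mulr_sumr; congr (_ * _).
rewrite indicE mem_setE in_itv/=.
case: (boolP (0 <= s <= t)) => h; last first.
  rewrite !mul0r; apply/esym/big1 => j _.
  by rewrite /cD cut_off2_out ?mul0r//; exact/negP.
have [s0 _] := andP h.
rewrite !mul1r mxE mulr_sumr; apply: eq_bigr => j _.
rewrite /cD /cZ !cut_off2E//; last by apply/quadrantE; rewrite t0.
by rewrite coordinateE//; ring.
Qed.

(** The forward equation is solved for [phi], multiplied by the discounted [Y] and averaged: Fubini
    on Om x R evaluates the drift term and [forward_martingale] the stochastic one. *)
Lemma forward_slice :
  (\int[P]_w (expR (- lambda * t) * (y w * phi t w i 0)) =
   \int[P]_w (expR (- lambda * t) * (y w * X t w i 0)) -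
   \sum_j \int[Q]_z pairing i j (z.1, (t, z.2)))%R.
Proof.
have [J [itoJ0 IE]] := itoI.
have itoJ k : is_ito1 P W k `[0, t]%classic
    (fun s w => (D k t s w *m X s w) i 0) (J i k).
  have -> : (fun s w => (D k t s w *m X s w) i 0) =
      fun s w => (\matrix_(i < n, k < D0) (D k t s w *m X s w) i 0) i k.
    by apply/funext => s; apply/funext => w; rewrite mxE.
  exact: itoJ0.
have sJ k : sqint P (J i k).
  have mA : measurable (`[0, t]%classic : set R) by [].
  by have [] := ito_isometry P_complete W_bm mA (@itv_0t_sub t) mA (@itv_0t_sub t)
    (itoJ k) (itoJ k).
pose drift (z : Om * RR) := \sum_j drift_pairing i j (z.1, (t, z.2)).
have sd : summable_fun Q drift by apply: summable_sum => j _; exact: sdrift.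
have [sv vE] := fubini_Rintegral1 sd.
set e := expR (- lambda * t).
have mart k : e * ip P y (J i k) =
    (\sum_j \int[Q]_z diffusion_pairing k i j (z.1, (t, z.2)))%R.
  exact: forward_martingale.
have syJ0 : summable_fun P (fun w => \sum_k (y w * J i k w)).
  by apply: summable_sum => k _; exact: sqint_mul.
have syJ := summableZ e syJ0.
have syX : summable_fun P (fun w => e * (y w * X t w i 0)).
  by apply/summableZ; exact: sqint_mul.
have syphi : summable_fun P (fun w => e * (y w * phi t w i 0)).
  by apply/summableZ; exact: sqint_mul.
have -> : (\int[P]_w (e * (y w * phi t w i 0)) = \int[P]_w (e * (y w * X t w i 0) -
    ((\int[mu]_s drift (w, s)) + e * \sum_k (y w * J i k w))))%R.
  apply: ae_eq_Rintegral.
  - exact: summable_measurable syphi.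
  - exact: (summable_measurable (summableB syX (summableD sv (summableZ e syJ0)))).
  apply: filterS2 (XE) (fubini_summable1 sd) => w Xw dw.
  have <- : e * y w * vint `[0, t]%classic (fun s => C t s w *m X s w) i 0 =
      (\int[mu]_s drift (w, s))%R.
    apply: scaled_vint dw => s; rewrite /= in_itv/=.
      move=> h; rewrite mxE mulr_sumr; apply: eq_bigr => j _.
      have [s0 _] := andP h.
      rewrite /drift_pairing /= /cC cut_off2E// !coordinateE// /e /y; ring.
    move=> h; rewrite /drift big1// => j _.
    by rewrite /drift_pairing /= /cC cut_off2_out// mul0r mulr0.
  rewrite Xw IE !mxE -mulr_sumr; ring.
rewrite RintegralB//; last exact: summableD.
rewrite RintegralD//; congr (_ - _).
rewrite vE RintegralZl//.
rewrite !Rintegral_sum; [|by move=> k _; exact: sqint_mul|by []].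
rewrite mulr_sumr (eq_bigr _ (fun k _ => mart k)).
rewrite exchange_big -big_split/=; apply: eq_bigr => j _.
rewrite /pairing RintegralD//; [|exact: sdrift|].
  by rewrite Rintegral_sum.
by apply: summable_sum => k _; exact: sdiff.
Qed.

End forward.

(** The factor in the backward equation moves the discount from [t] to the later time s, where the
    pairings carry it. *)
Lemma expR_discount_split (t s : R) :
  expR (- lambda * t) * expR (- lambda * (s - t)) = expR (- lambda * s).
Proof. by rewrite -expRD; congr expR; ring. Qed.

(** * The backward equation at a fixed time *)

Section backward.
Variables (psi : R -> Om -> 'cV[R]_n) (t : R) (i : 'I_n).
Hypothesis t0 : 0 <= t.
Variable I : Om -> 'cV[R]_n.
Hypotheses (itoI : is_ito P W `[t, +oo[%classic (Z t) I)
  (YE : {ae P, forall w, Y t w = psi t w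
          + vint `[t, +oo[%classic (fun s => expR (- lambda * (s - t)) *:
              ((C s t w)^T *m Y s w
               + \sum_k (D k s t w)^T *m col k (Z s t w)))
          - I w}).
Hypotheses (sX : sqint P (fun w => X t w i 0)) (sY : sqint P (fun w => Y t w i 0))
  (spsi : sqint P (fun w => psi t w i 0))
  (FX : F_measurable P W t (fun w => X t w i 0)).
Hypothesis spair : forall j, summable_fun Q (fun z => pairing j i (z.1, (z.2, t))).

Let x w := X t w i 0.

(** Now [t] is the earlier time, so it stands in the second slot of the pairing. The transposes
    exchange the indices: [i] belongs to [X] and becomes the column, while the sum runs over the row
    [j] of [Y] and [Z]. *)
Lemma backward_slice :
  (\int[P]_w (expR (- lambda * t) * (psi t w i 0 * x w)) =
   \int[P]_w (expR (- lambda * t) * (Y t w i 0 * x w)) -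
   \sum_j \int[Q]_z pairing j i (z.1, (z.2, t)))%R.
Proof.
have [J [itoJ IE]] := itoI.
have mA : measurable (`[t, +oo[%classic : set R) by [].
have A0 : `[t, +oo[%classic `<=` halfline.
  by move=> s /=; rewrite !in_itv/= !andbT; exact: le_trans.
have sJ k : sqint P (J i k).
  by have [] := ito_isometry P_complete W_bm mA A0 mA A0 (itoJ i k) (itoJ i k).
have orth k : ip P x (J i k) = 0.
  by apply: (ito_orthogonal_past P_complete W_bm t0 mA _ (itoJ i k) FX sX).
pose total (z : Om * RR) := \sum_j pairing j i (z.1, (z.2, t)).
have st : summable_fun Q total by apply: summable_sum => j _; exact: spair.
have [sv vE] := fubini_Rintegral1 st.
set e := expR (- lambda * t).
have sxJ0 : summable_fun P (fun w => \sum_k (x w * J i k w)).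
  by apply: summable_sum => k _; exact: sqint_mul.
have sxJ := summableZ e sxJ0.
have sYx : summable_fun P (fun w => e * (Y t w i 0 * x w)).
  by apply/summableZ; exact: sqint_mul.
have spsix : summable_fun P (fun w => e * (psi t w i 0 * x w)).
  by apply/summableZ; exact: sqint_mul.
have -> : (\int[P]_w (e * (psi t w i 0 * x w)) = \int[P]_w (e * (Y t w i 0 * x w) -
    ((\int[mu]_s total (w, s)) - e * \sum_k (x w * J i k w))))%R.
  apply: ae_eq_Rintegral.
  - exact: summable_measurable spsix.
  - exact: (summable_measurable (summableB sYx (summableB sv sxJ))).
  apply: filterS2 (YE) (fubini_summable1 st) => w Yw tw.
  have vintE : e * x w * vint `[t, +oo[%classic (fun s => expR (- lambda * (s - t)) *:
              ((C s t w)^T *m Y s w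
               + \sum_k (D k s t w)^T *m col k (Z s t w))) i 0 =
      (\int[mu]_s total (w, s))%R.
    apply: scaled_vint tw => s; rewrite /= in_itv/= andbT => ts; last first.
      by rewrite /total big1// => j _; rewrite pairing_out// => /triangleE/andP[_].
    have s0 := le_trans t0 ts.
    have tri : triangle (s, t) by apply/triangleE; rewrite t0.
    have -> r : e * x w * (expR (- lambda * (s - t)) *: r : 'cV_n) i 0 =
        expR (- lambda * s) * (x w * r i 0).
      by rewrite mxE -(expR_discount_split t s) /e; ring.
    rewrite mxE summxE mxE !mulrDr !mulr_sumr.
    rewrite /total /pairing big_split/=; congr (_ + _).
      apply: eq_bigr => j _.
      by rewrite /drift_pairing /= /cC cut_off2E// !coordinateE// mxE /x; ring.
    rewrite exchange_big; apply: eq_bigr => k _ /=; rewrite mxE !mulr_sumr.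
    apply: eq_bigr => j _.
    rewrite /diffusion_pairing /= /cD /cZ !cut_off2E//; last first.
      by apply/quadrantE; rewrite s0.
    by rewrite coordinateE// !mxE /x; ring.
  rewrite -vintE Yw IE !mxE -mulr_sumr /x; ring.
rewrite RintegralB//; last exact: summableB.
rewrite RintegralB//; congr (_ - _).
rewrite vE RintegralZl// [X in _ - _ * X]Rintegral_sum; last first.
  by move=> k _; exact: sqint_mul.
rewrite [X in _ - _ * X]big1 ?mulr0 ?subr0; last by move=> k _; exact: orth.
by rewrite Rintegral_sum.
Qed.

End backward.

End Pairings.

(** * Integration over time *)

Section Duality.
Context d (Om : measurableType d) (R : realType) (P : probability Om R).
Hypothesis P_complete : measure_is_complete P.
Variables (n D0 : nat) (W : 'I_D0 -> R -> Om -> R).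
Hypothesis W_bm : brownian_motion P W.
Local Notation mu := (@lebesgue_measure R).
Local Notation RR := (measurableTypeR R).
Local Notation Q := (P \x mu)%E.
Local Notation S := (P \x tensor mu mu)%E.
Local Notation halfline := (`[0, +oo[%classic : set R).
Local Notation quadrant := (halfline `*` halfline).

Lemma coordinate_slices beta (f : R -> Om -> 'cV[R]_n) : L2_Finfty P W beta f ->
  {ae mu, forall t, 0 <= t -> forall i, sqint P (fun w => f t w i 0)}.
Proof.
move=> Lf.
have h i := sqint_slice (L2_Finfty_measurable P_complete W_bm i Lf)
  (L2_Finfty_sqint P_complete W_bm i Lf).
apply: filterS (ae_forall_fin h) => t ht t0 i.
by apply: eq_sqint (ht i) => w; rewrite coordinateE.
Qed.

Variables (C : R -> R -> Om -> 'M[R]_n) (D : 'I_D0 -> R -> R -> Om -> 'M[R]_n).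
Hypotheses (C_proc : triangle_process P W C)
  (D_proc : forall k, triangle_process P W (D k)).
Variables (KC KD : R -> R).
Hypotheses (KC_L1 : Lstar 1 KC) (KD_L2 : Lstar 2 KD)
  (C_bound : {ae (@lebesgue_measure R \x @lebesgue_measure R)%E,
       forall u : R * R, triangle u ->
       {ae P, forall w, frob (C u.1 u.2 w) <= KC (u.1 - u.2)}})
  (D_bound : {ae (@lebesgue_measure R \x @lebesgue_measure R)%E,
       forall u : R * R, triangle u ->
       {ae P, forall w,
         Num.sqrt (\sum_k frob (D k u.1 u.2 w) ^+ 2) <= KD (u.1 - u.2)}}).
Variables (rate eta lambda : R).
Hypotheses (rate_le : rate <= eta + lambda) (rate_gt : (rho_CD KC KD < rate%:E)%E).
Variables (X Y : R -> Om -> 'cV[R]_n) (Z : R -> R -> Om -> 'M[R]_(n, D0)).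
Hypotheses (X_L2 : L2_F P W (- rate) X) (Y_L2 : L2_F P W eta Y)
  (Z_L2 : L2_F2 P W eta Z).

Let triangle_bound (c : R -> R -> Om -> R) (K : R -> R) :
  (forall r, 0 <= r -> 0 <= K r) ->
  {ae (@lebesgue_measure R \x @lebesgue_measure R)%E,
     forall u : R * R, triangle u -> {ae P, forall w, `|c u.1 u.2 w| <= K (u.1 - u.2)}} ->
  {ae tensor mu mu, forall u, {ae P, forall w,
     `|cut_off2 (@triangle R) c (w, u)| <= kernel_on_halfline K (u.1 - u.2)}}.
Proof.
move=> K0; apply: (ae_imply (m := tensor mu mu)) => -[t s] h.
have [tri|ntri] := pselect (triangle (t, s)); last first.
  by apply: nearW => w; rewrite cut_off2_out// normr0 kernel_on_halfline_ge0.
apply: filterS (h tri) => w; rewrite cut_off2E//=.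
by rewrite kernel_on_halflineE// subr_ge0; case/andP: tri.
Qed.

Lemma drift_summable i j : summable_fun S (drift_pairing C lambda X Y i j).
Proof.
apply: (summable_drift rate_le (K := kernel_on_halfline KC)).
- apply: measurable_cut_off2; [exact: measurable_triangle|exact: C_proc.1].
- by apply: kernel_on_halfline_ge0; case: KC_L1.
- apply: triangle_bound; first by case: KC_L1.
  apply: (ae_imply (m := tensor mu mu)) C_bound => u h /h; apply: filterS => w; apply: le_trans.
  exact: le_frob.
- exact: (L2_Finfty_measurable P_complete W_bm j X_L2.1).
- exact: (L2_Finfty_sqint P_complete W_bm j X_L2.1).
- exact: (L2_Finfty_measurable P_complete W_bm i Y_L2.1).
- by move=> w t t0; rewrite coordinate_lt0.
- exact: (L2_Finfty_sqint P_complete W_bm i Y_L2.1).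
- exact: (rho_CD_lt_summable KC_L1 KD_L2 rate_gt).1.
Qed.

Lemma diffusion_summable k i j : summable_fun S (diffusion_pairing D lambda X Z k i j).
Proof.
apply: (summable_diffusion rate_le (K := kernel_on_halfline KD)).
- apply: measurable_cut_off2; [exact: measurable_triangle|exact: (D_proc k).1].
- apply: triangle_bound; first by case: KD_L2.
  apply: (ae_imply (m := tensor mu mu)) D_bound => u h /h; apply: filterS => w; apply: le_trans.
  apply: le_trans (le_frob _ i j) _.
  apply: le_trans (le_sqrt_sum (fun k => frob (D k u.1 u.2 w)) k).
  exact: ler_norm.
- exact: (L2_Finfty_measurable P_complete W_bm j X_L2.1).
- exact: (L2_Finfty_sqint P_complete W_bm j X_L2.1).
- exact: (L2_F2_measurable i k Z_L2).
- by move=> w t s t0; rewrite cut_off2_out// => /quadrantE/andP[]; rewrite leNgt t0.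
- exact: (L2_F2_summable i k Z_L2).
- exact: (rho_CD_lt_summable KC_L1 KD_L2 rate_gt).2.
Qed.

Lemma pairing_summable i j : summable_fun S (pairing C D lambda X Y Z i j).
Proof.
apply: summableD; first exact: drift_summable.
by apply: summable_sum => k _; exact: diffusion_summable.
Qed.

Let total z := \sum_i \sum_j pairing C D lambda X Y Z i j z.

Let total_summable : summable_fun S total.
Proof.
by apply: summable_sum => i _; apply: summable_sum => j _; exact: pairing_summable.
Qed.

Let total_out w t s : ~ triangle (t, s) -> total (w, (t, s)) = 0.
Proof.
by move=> h; rewrite /total big1// => i _; rewrite big1// => j _; exact: pairing_out.
Qed.

(** At negative times every term vanishes, so the identity holds for almost every real [t] and can
    be integrated over the whole line. *)
Lemma forward_balance phi : L2_F P W (- rate) phi -> forward_SVIE P W C D phi X ->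
  {ae mu, forall t, 0 <= t -> exists I, is_ito P W `[0, t]%classic (Z t) I /\
     {ae P, forall w, Y t w = vexpect P (Y t) + I w}} ->
  {ae mu, forall t, (\int[P]_w discounted_inner lambda Y phi (w, t) =
     \int[P]_w discounted_inner lambda Y X (w, t) -
     \int[Q]_z total (z.1, (t, z.2)))%R}.
Proof.
move=> phi_L2 X_sol Y_mart.
have sdrift : {ae mu, forall t, forall ij, summable_fun Q
    (fun z => drift_pairing C lambda X Y ij.1 ij.2 (z.1, (t, z.2)))}.
  apply: ae_forall_fin => ij.
  by have [] := fubini_slot1 (drift_summable ij.1 ij.2).
have sdiff : {ae mu, forall t, forall kij, summable_fun Q
    (fun z => diffusion_pairing D lambda X Z kij.1 kij.2.1 kij.2.2 (z.1, (t, z.2)))}.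
  apply: ae_forall_fin => kij.
  by have [] := fubini_slot1 (diffusion_summable kij.1 kij.2.1 kij.2.2).
have sl := aeI (coordinate_slices X_L2.1) (aeI (coordinate_slices Y_L2.1)
  (coordinate_slices phi_L2.1)).
apply: ae_imply (aeI (aeI X_sol Y_mart) (aeI sl (aeI sdrift sdiff))).
move=> t [[Xt Yt] [[sX [sY sphi]] [st1 st2]]].
have [t0|t0] := ltP t 0.
  rewrite [X in _ = _ - X](_ : _ = 0) ?subr0; last first.
    rewrite /Rintegral integral0_eq// => z _.
    by rewrite total_out// => /triangleE/andP[s0 /(le_trans s0)]; rewrite leNgt t0.
  by apply: eq_Rintegral => w _; rewrite !discounted_inner_lt0.
have [I [itoI XE]] := Xt t0; have [I' [itoI' YE]] := Yt t0.
have sp i j : summable_fun Q (fun z => pairing C D lambda X Y Z i j (z.1, (t, z.2))).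
  apply: summableD; first exact: (st1 (i, j)).
  by apply: summable_sum => k _; exact: (st2 (k, (i, j))).
rewrite !discounted_inner_slice//; try by [exact: sX|exact: sY|exact: sphi].
rewrite Rintegral_sum; last by move=> i _; apply: summable_sum => j _; exact: sp.
rewrite -sumrB; apply: eq_bigr => i _; rewrite Rintegral_sum//.
apply: (forward_slice P_complete W_bm t0 itoI XE itoI' YE (sX t0 i) (sY t0 i) (sphi t0 i)).
  by move=> j; exact: (st1 (i, j)).
by move=> k j; exact: (st2 (k, (i, j))).
Qed.

Lemma backward_balance psi : L2_Finfty P W eta psi ->
  backward_SVIE P W C D lambda psi Y Z ->
  {ae mu, forall t, (\int[P]_w discounted_inner lambda psi X (w, t) =
     \int[P]_w discounted_inner lambda Y X (w, t) -
     \int[Q]_z total (z.1, (z.2, t)))%R}.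
Proof.
move=> psi_L2 Y_sol.
have spair : {ae mu, forall t, forall ij, summable_fun Q
    (fun z => pairing C D lambda X Y Z ij.1 ij.2 (z.1, (z.2, t)))}.
  apply: ae_forall_fin => ij.
  by have [] := fubini_slot2 (pairing_summable ij.1 ij.2).
have sl := aeI (coordinate_slices X_L2.1) (aeI (coordinate_slices Y_L2.1)
  (coordinate_slices psi_L2)).
apply: ae_imply (aeI Y_sol (aeI sl spair)) => t [Yt [[sX [sY spsi]] st]].
have [t0|t0] := ltP t 0.
  rewrite [X in _ = _ - X](_ : _ = 0) ?subr0; last first.
    rewrite /Rintegral integral0_eq// => z _.
    by rewrite total_out// => /triangleE/andP[]; rewrite leNgt t0.
  by apply: eq_Rintegral => w _; rewrite !discounted_inner_lt0.
have [I [itoI YE]] := Yt t0.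
have sp i j : summable_fun Q (fun z => pairing C D lambda X Y Z i j (z.1, (z.2, t))).
  exact: (st (i, j)).
rewrite !discounted_inner_slice//; try by [exact: sX|exact: sY|exact: spsi].
rewrite Rintegral_sum; last by move=> i _; apply: summable_sum => j _; exact: sp.
under [X in _ = _ - X]eq_bigr => i _ do
  (rewrite Rintegral_sum; last by move=> j _; exact: sp).
(* The outer index of [total] belongs to [Y], whereas [backward_slice] fixes that of [X]. *)
rewrite exchange_big -sumrB; apply: eq_bigr => i _.
apply: (backward_slice P_complete W_bm t0 itoI YE (sX t0 i) (sY t0 i) (spsi t0 i)).
  exact: X_L2.2.
by move=> j; exact: sp.
Qed.

Lemma duality phi psi : L2_F P W (- rate) phi -> L2_Finfty P W eta psi ->
  forward_SVIE P W C D phi X -> M2_F P W eta Y Z ->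
  backward_SVIE P W C D lambda psi Y Z ->
  ('E_P[fun w => (\int[mu]_(t in halfline)
                    (expR (- lambda * t) * inner (psi t w) (X t w)))%R] =
   'E_P[fun w => (\int[mu]_(t in halfline)
                    (expR (- lambda * t) * inner (Y t w) (phi t w)))%R])%E.
Proof.
move=> phi_L2 psi_L2 X_sol [_ _ Y_mart] Y_sol.
have sum_ (f g : R -> Om -> 'cV[R]_n) (Lf : L2_Finfty P W eta f)
    (Lg : L2_Finfty P W (- rate) g) : summable_fun Q (discounted_inner lambda f g).
  apply: (discounted_inner_summable rate_le).
  - by move=> i; exact: (L2_Finfty_measurable P_complete W_bm i Lf).
  - by move=> i; exact: (L2_Finfty_measurable P_complete W_bm i Lg).
  - by move=> i; exact: (L2_Finfty_sqint P_complete W_bm i Lf).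
  - by move=> i; exact: (L2_Finfty_sqint P_complete W_bm i Lg).
have [s1 ->] := expectation_discounted_inner (sum_ _ _ psi_L2 X_L2.1).
have [s2 ->] := expectation_discounted_inner (sum_ _ _ Y_L2.1 phi_L2.1).
have [s3 _] := expectation_discounted_inner (sum_ _ _ Y_L2.1 X_L2.1).
have [_ s4 e4] := fubini_slot1 total_summable.
have [_ s5 e5] := fubini_slot2 total_summable.
(* Each balance, integrated over time, gives this value: [e5] evaluates the correction with the
   second time fixed, [e4] with the first. *)
congr EFin; transitivity ((\int[mu]_t (\int[P]_w discounted_inner lambda Y X (w, t))) -
    \int[S]_z total z)%R.
  rewrite -e5 -RintegralB//; apply: ae_eq_Rintegral.
  - exact: summable_measurable s1.
  - exact: (summable_measurable (summableB s3 s5)).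
  - exact: backward_balance.
rewrite -e4 -RintegralB//; apply/esym/ae_eq_Rintegral.
- exact: summable_measurable s2.
- exact: (summable_measurable (summableB s3 s4)).
- exact: forward_balance.
Qed.

End Duality.

Theorem theorem3p15 (disp : measure_display) (Om : measurableType disp)
    (R : realType) (P : probability Om R)
    (P_complete : measure_is_complete P)
    (n d : nat) (W : 'I_d -> R -> Om -> R) (W_bm : brownian_motion P W)
    (C : R -> R -> Om -> 'M[R]_n) (D : 'I_d -> R -> R -> Om -> 'M[R]_n)
    (C_proc : triangle_process P W C)
    (D_proc : forall k, triangle_process P W (D k))
    (KC KD : R -> R) (KC_L1 : Lstar 1 KC) (KD_L2 : Lstar 2 KD)
    (C_bound : {ae (@lebesgue_measure R \x @lebesgue_measure R)%E,
       forall u : R * R, triangle u ->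
       {ae P, forall w, frob (C u.1 u.2 w) <= KC (u.1 - u.2)}})
    (D_bound : {ae (@lebesgue_measure R \x @lebesgue_measure R)%E,
       forall u : R * R, triangle u ->
       {ae P, forall w,
         Num.sqrt (\sum_k frob (D k u.1 u.2 w) ^+ 2) <= KD (u.1 - u.2)}})
    (mu eta lambda : R)
    (mu_le : mu <= eta + lambda) (mu_gt : (rho_CD KC KD < mu%:E)%E)
    (phi psi : R -> Om -> 'cV[R]_n)
    (phi_L2 : L2_F P W (- mu) phi) (psi_L2 : L2_Finfty P W eta psi)
    (X : R -> Om -> 'cV[R]_n)
    (X_L2 : L2_F P W (- mu) X) (X_sol : forward_SVIE P W C D phi X)
    (Y : R -> Om -> 'cV[R]_n) (Z : R -> R -> Om -> 'M[R]_(n, d))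
    (YZ_M2 : M2_F P W eta Y Z) (YZ_sol : backward_SVIE P W C D lambda psi Y Z) :
  ('E_P[fun w => (\int[lebesgue_measure]_(t in `[0, +oo[)
                    (expR (- lambda * t) * inner (psi t w) (X t w)))%R] =
   'E_P[fun w => (\int[lebesgue_measure]_(t in `[0, +oo[)
                    (expR (- lambda * t) * inner (Y t w) (phi t w)))%R])%E.
Proof.
have [Y_L2 Z_L2 _] := YZ_M2.
exact: (duality P_complete W_bm C_proc D_proc KC_L1 KD_L2 C_bound D_bound
  mu_le mu_gt X_L2 Y_L2 Z_L2 phi_L2 psi_L2 X_sol YZ_M2 YZ_sol).
Qed.
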